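(* Let $(M,g)$ be a Riemannian manifold of dimension $m\geq2$ with a metric connection $\nabla$ (i.e. $\nabla g=0$, torsion allowed). Let $f_1=e^{2\varphi_1}$, $f_2=e^{2\varphi_2}$ with $\varphi_1,\varphi_2\in C^\infty(M)$, and let $f_3\in C^\infty(M)$ with $f_1+f_3>0$. Consider the linear connection $\tilde D^*=\nabla^{*,f_1}\oplus\nabla^{*,f_2}$ on $TTM=H\oplus V$ over $TM$, defined in the context. (i) If $f_3=0$, then $g^{f_1,f_2}$ is parallel for the connection $\tilde D^*$. (ii) If $f_1,f_3$ are constants, then $G=g^{f_1,f_2}+f_3\,\mu\otimes\mu$ is parallel for $\tilde{\tilde D}^*=\tilde D^*+K$, where $$K_XY=\Bigl(\frac{f_3}{f_1}\theta^tX-\frac{r^2f_3^2}{(r^2f_3+f_1)f_1}\Omega(X)\,\theta^t\xi\Bigr)\mu(Y)$$ and where $r^2=\|\xi\|^2$ and $\Omega(X)=\frac1{r^2}\langle\xi,X^v\rangle$, so that $\mu(\theta^tX)=\Omega(X)r^2$. (iii) The connection $\nabla^{*,f_2,'}_XY=\nabla^*_XY+X(\varphi_2)Y$ on $V$ is also metric on $(V,f_2\pi^*g)$.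
   Context: Let $\pi:TM\to M$ be the bundle projection and $V=\ker d\pi\subset TTM$ the vertical bundle, canonically identified with $\pi^*TM$. Let $\xi$ be the canonical vertical vector field on $TM$, $\xi_u=u$, and $\nabla^*=\pi^*\nabla$ the pull-back connection on $\pi^*TM$. Then $H=\{X\in TTM:\ \nabla^*_X\xi=0\}$ is a complement of $V$ and $d\pi$ restricts to an isomorphism $H\cong\pi^*TM$. Write $X=X^h+X^v$ for the decomposition along $H\oplus V$. Through $H\cong\pi^*TM\cong V$, $\nabla^*$ also denotes the induced connections on $H$ and on $V$. The endomorphism $\theta:TTM\to TTM$ sends a horizontal vector to the corresponding vertical vector under $H\cong\pi^*TM\cong V$ and sends $V$ to $0$; $\theta^t$ sends a vertical vector to the corresponding horizontal vector and sends $H$ to $0$. The bracket $\langle\ ,\ \rangle$ denotes $g$, and on $TTM$ the Sasaki metric $\pi^*g\oplus\pi^*g$ (with $H\perp V$); $\|\xi\|^2=\langle\xi,\xi\rangle$. The 1-form $\mu$ is $\mu(X)=\langle\xi,\theta X\rangle$. Also $g^{f_1,f_2}=f_1\pi^*g\oplus f_2\pi^*g$ on $H\oplus V$. Functions on $M$ are composed with $\pi$ when used on $TM$; $X(\varphi)=d\varphi(X)$. For $i=1,2$ put on $M$: $C_i(X,Y)=X(\varphi_i)Y+Y(\varphi_i)X-\langle X,Y\rangle\,\mathrm{grad}\,\varphi_i$ (gradient with respect to $g$). On $H$: $\nabla^{*,f_1}=\nabla^*+\pi^*C_1$. On $V$: $\nabla^{*,f_2}_XY=\nabla^*_XY+\theta\,\pi^*C_2(X,\theta^tY)$.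 Here $\pi^*C_i$ is regarded as $H$-valued and depends only on the horizontal parts of its arguments.
   Formalization: In (ii), parallelism of G is stated at the points of TM where r^2 f_3 + f_1 is nonzero; if f_3 < 0 this denominator of K vanishes on a sphere bundle (e.g. f_1 = 1, f_3 = -1/2, r^2 = 2), where K is undefined. *)

(* Defs.v *)
From HB Require Import structures.
From mathcomp Require Import all_boot all_order all_algebra.
From mathcomp Require Import all_classical all_reals all_analysis.
Import Order.TTheory GRing.Theory Num.Theory.
Import numFieldNormedType.Exports.

Set Implicit Arguments.
Unset Strict Implicit.
Unset Printing Implicit Defensive.

Local Open Scope classical_set_scope.
Local Open Scope ring_scope.

(* Only used with finite-dimensional E and F: there, f is C^(k+1) iff it is
   differentiable with all its directional derivatives of class C^k. *)
Fixpoint Ck (R : realType) (E F : normedModType R) (k : nat) (U : set E)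
    (f : E -> F) : Prop :=
  if k is k'.+1 then
    (forall x, U x -> differentiable f x) /\
    (forall v : E, Ck k' U (fun x => 'D_v f x))
  else forall x, U x -> {for x, continuous f}.

Definition smooth_at (R : realType) (E F : normedModType R) (f : E -> F)
    (x : E) : Prop :=
  exists U : set E, [/\ open U, U x & forall k, Ck k U f].

(* A set with an atlas modelled on E.  As the values of coord a outside dom a
   and of param a outside the image of dom a are arbitrary, only germs at
   points of these sets matter. The preferred chart pref p at each point p is
   used to trivialise the tangent space at p. *)
Record charted (R : realType) (E : normedModType R) := Charted {
  pt :> Type;
  chart : Type;
  dom : chart -> set pt;
  coord : chart -> pt -> E;
  param : chart -> E -> pt;
  pref : pt -> chart }.

Section Manifolds.
Context {R : realType}.

(* The coordinates of p, and the inverse parametrisation, in the chart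
   preferred at p. *)
Definition pcoord (E : normedModType R) (N : charted E) (p : N) : N -> E :=
  coord (pref p).
Definition pparam (E : normedModType R) (N : charted E) (p : N) : E -> N :=
  param (pref p).

(* "P holds in a neighbourhood of p", for the topology induced by the atlas *)
Definition nearby (E : normedModType R) (N : charted E) (p : N)
    (P : set N) : Prop :=
  \forall x \near pcoord p p, P (pparam p x).

Definition mopen (E : normedModType R) (N : charted E) (O : set N) : Prop :=
  forall p, O p -> nearby p O.

Definition is_manifold (E : normedModType R) (N : charted E) : Prop :=
  [/\ (forall p : N, dom (pref p) p),
      (forall (a : chart N) (p : N), dom a p -> param a (coord a p) = p),
      (forall a b : chart N,
         open (coord a @` (dom a `&` dom b)) /\
         (forall p : N, dom a p -> dom b p ->
            smooth_at (coord b \o param a) (coord a p))),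
      (forall p q : N, p <> q ->
         exists O1 O2 : set N,
           [/\ mopen O1, mopen O2, O1 p, O2 q & O1 `&` O2 = set0]) &
      (exists B : nat -> set N,
         (forall n, mopen (B n)) /\
         (forall (O : set N) p, mopen O -> O p ->
            exists n, B n p /\ B n `<=` O))].

Definition smooth_map (E F : normedModType R) (N : charted E) (N' : charted F)
    (f : N -> N') (p : N) : Prop :=
  (forall P : set N', nearby (f p) P -> nearby p (f @^-1` P)) /\
  smooth_at (pcoord (f p) \o f \o pparam p) (pcoord p p).

Definition smooth_fun (E : normedModType R) (N : charted E) (f : N -> R)
    (p : N) : Prop :=
  smooth_at (f \o pparam p : E -> R^o) (pcoord p p).

(* The tangent space of N at p is the model space E, through the differential
   at p of the preferred chart at p; it is in particular a vector space.
   dmap f p X and dfun f p X are then the differentials of a map and of a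
   function at p, evaluated at the tangent vector X. *)
Definition dmap (E F : normedModType R) (N : charted E) (N' : charted F)
    (f : N -> N') (p : N) (X : E) : F :=
  'D_X (pcoord (f p) \o f \o pparam p) (pcoord p p).

Definition dfun (E : normedModType R) (N : charted E) (f : N -> R) (p : N)
    (X : E) : R :=
  'D_X (f \o pparam p : E -> R^o) (pcoord p p).

(* The pair (p, X) is the vector X tangent at p.  A chart of N reads X through
   the differential of the change of chart from the preferred chart at p. *)
Definition tangent (E : normedModType R) (N : charted E) : charted (E * E)%type :=
  @Charted R (E * E)%type (N * E)%type (chart N)
    (fun a u => dom a u.1)
    (fun a u => (coord a u.1,
                 'D_(u.2) (coord a \o pparam u.1) (pcoord u.1 u.1)))
    (fun a x => (param a x.1,
                 'D_(x.2) (pcoord (param a x.1) \o param a) x.1))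
    (fun u => pref u.1).

(* A section s of the pull-back bundle f^* TN', with s q tangent at f q;
   with f the identity, s is a vector field. *)
Definition smooth_section (E F : normedModType R) (N : charted E)
    (N' : charted F) (f : N -> N') (s : N -> F) (p : N) : Prop :=
  smooth_map (fun q => (f q, s q) : tangent N') p.

Definition smooth_field (E : normedModType R) (N : charted E) (Y : N -> E)
    (p : N) : Prop :=
  smooth_section (fun q : N => q) Y p.

(* Linear connections on f^* TN', as operators on germs of smooth sections:
   D p X s is the covariant derivative of s at p in the direction X. *)
Definition is_connection (E F : normedModType R) (N : charted E)
    (N' : charted F) (f : N -> N') (D : N -> E -> (N -> F) -> F) : Prop :=
  [/\ (forall p (a : R) (X Y : E) s, smooth_section f s p ->
         D p (a *: X + Y) s = a *: D p X s + D p Y s),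
      (forall p X s t, smooth_section f s p -> smooth_section f t p ->
         D p X (fun q => s q + t q) = D p X s + D p X t),
      (forall p X (h : N -> R) s, smooth_fun h p -> smooth_section f s p ->
         D p X (fun q => h q *: s q) = dfun h p X *: s p + h p *: D p X s),
      (forall p X s t, smooth_section f s p ->
         nearby p (fun q => s q = t q) -> D p X s = D p X t) &
      (forall p X s, smooth_field X p -> smooth_section f s p ->
         smooth_section f (fun q => D q (X q) s) p)].

Definition linear_connection (E : normedModType R) (N : charted E)
    (D : N -> E -> (N -> E) -> E) : Prop :=
  is_connection (fun q : N => q) D.

Definition is_pullback (E F : normedModType R) (N : charted E)
    (N' : charted F) (f : N -> N') (D : N' -> F -> (N' -> F) -> F)
    (Ds : N -> E -> (N -> F) -> F) : Prop :=
  is_connection f Ds /\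
  forall p X (Y : N' -> F), smooth_field Y (f p) ->
    Ds p X (Y \o f) = D (f p) (dmap f p X) Y.

Definition is_riemannian (E : normedModType R) (N : charted E)
    (g : N -> E -> E -> R) : Prop :=
  [/\ (forall p (a : R) X Y Z, g p (a *: X + Y) Z = a * g p X Z + g p Y Z),
      (forall p X Y, g p X Y = g p Y X),
      (forall p X, X != 0 -> 0 < g p X X) &
      (forall p (X Y : N -> E), smooth_field X p -> smooth_field Y p ->
         smooth_fun (fun q => g q (X q) (Y q)) p)].

(* The bilinear form B on the subbundle S of TN satisfies DB = 0 at p. *)
Definition parallel_on (E : normedModType R) (N : charted E)
    (S : N -> set E) (D : N -> E -> (N -> E) -> E) (B : N -> E -> E -> R)
    (p : N) : Prop :=
  forall (X : E) (Y Z : N -> E),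
    smooth_field Y p -> smooth_field Z p ->
    nearby p (fun q => S q (Y q)) -> nearby p (fun q => S q (Z q)) ->
    is_derive (pcoord p p) X
      ((fun q => B q (Y q) (Z q)) \o pparam p : E -> R^o)
      (B p (D p X Y) (Z p) + B p (Y p) (D p X Z)).

Definition parallel_at (E : normedModType R) (N : charted E)
    (D : N -> E -> (N -> E) -> E) (B : N -> E -> E -> R) (p : N) : Prop :=
  parallel_on (fun=> setT) D B p.

Definition gradient (E : normedModType R) (N : charted E)
    (g : N -> E -> E -> R) (phi : N -> R) (p : N) : E :=
  xget 0 [set v | forall w, g p v w = dfun phi p w].

Definition Cconf (E : normedModType R) (N : charted E)
    (g : N -> E -> E -> R) (phi : N -> R) (p : N) (X Y : E) : E :=
  dfun phi p X *: Y + dfun phi p Y *: X - g p X Y *: gradient g phi p.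

End Manifolds.

(* The geometry of TM -> M for a Riemannian metric g on M and the pull-back Ds
   to TM -> M of a connection of M.  Vectors tangent to TM at u live in E * E,
   the vectors of (pi^* TM)_u in E.  The uses of xget below select elements
   which exist and are unique when Ds is a pull-back connection. *)
Section TangentGeometry.
Context {R : realType} {E : normedModType R} {M : charted E}.

Local Notation TM := (tangent M).
Local Notation TTM := (E * E)%type.

Definition tproj (u : TM) : M := u.1.

(* The canonical vertical field xi as a section of pi^* TM *)
Definition tautological (u : TM) : E := u.2.

Definition dproj (u : TM) (X : TTM) : E := dmap tproj u X.

Definition vertical (u : TM) : set TTM := [set X | dproj u X = 0].

(* The canonical isomorphism (pi^* TM)_u -> V_u, sending w to the velocity at
   t = 0 of the curve t |-> u + t w, and its inverse. *)
Definition vlift (u : TM) (w : E) : TTM :=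
  'D_w (fun v : E => pcoord u ((tproj u, v) : TM)) (tautological u).

Definition vdrop (u : TM) (X : TTM) : E := xget 0 [set w | vlift u w = X].

Definition canon_vert (u : TM) : TTM := vlift u (tautological u).

Section Horizontal.
Variable Ds : TM -> TTM -> (TM -> E) -> E.

Definition horizontal (u : TM) : set TTM :=
  [set X | Ds u X tautological = 0].

Definition hpart (u : TM) (X : TTM) : TTM :=
  xget 0 [set Y | horizontal u Y /\ vertical u (X - Y)].
Definition vpart (u : TM) (X : TTM) : TTM := X - hpart u X.

(* The inverse of the isomorphism d pi : H_u -> (pi^* TM)_u *)
Definition hlift (u : TM) (w : E) : TTM :=
  xget 0 [set X | horizontal u X /\ dproj u X = w].

Definition theta_map (u : TM) (X : TTM) : TTM :=
  vlift u (dproj u (hpart u X)).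
Definition theta_t (u : TM) (X : TTM) : TTM :=
  hlift u (vdrop u (vpart u X)).

Definition nablaH (u : TM) (X : TTM) (Y : TM -> TTM) : TTM :=
  hlift u (Ds u X (fun w => dproj w (Y w))).
Definition nablaV (u : TM) (X : TTM) (Y : TM -> TTM) : TTM :=
  vlift u (Ds u X (fun w => vdrop w (Y w))).

Variable g : M -> E -> E -> R.

Definition gV (f : M -> R) (u : TM) (X Y : TTM) : R :=
  f (tproj u) * g (tproj u) (vdrop u X) (vdrop u Y).

Definition gweighted (f1 f2 : M -> R) (u : TM) (X Y : TTM) : R :=
  f1 (tproj u) * g (tproj u) (dproj u (hpart u X)) (dproj u (hpart u Y))
  + gV f2 u (vpart u X) (vpart u Y).

Definition sasaki : TM -> TTM -> TTM -> R :=
  gweighted (fun=> 1) (fun=> 1).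

Definition mu_form (u : TM) (X : TTM) : R := sasaki u (canon_vert u) (theta_map u X).

Definition rsq (u : TM) : R := sasaki u (canon_vert u) (canon_vert u).

(* Undefined on the zero section in the source; here 0^-1 = 0 gives it the
   value 0 there, as it does for rsq u * Omega u X = <xi, X^v>. *)
Definition Omega (u : TM) (X : TTM) : R :=
  (rsq u)^-1 * sasaki u (canon_vert u) (vpart u X).

Definition pullC (phi : M -> R) (u : TM) (X Y : TTM) : TTM :=
  hlift u (Cconf g phi (tproj u) (dproj u (hpart u X)) (dproj u (hpart u Y))).

Definition nablaH_conf (phi1 : M -> R) (u : TM) (X : TTM) (Y : TM -> TTM)
    : TTM :=
  nablaH u X Y + pullC phi1 u X (Y u).

Definition nablaV_conf (phi2 : M -> R) (u : TM) (X : TTM) (Y : TM -> TTM)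
    : TTM :=
  nablaV u X Y + theta_map u (pullC phi2 u X (theta_t u (Y u))).

Definition Dtilde (phi1 phi2 : M -> R) (u : TM) (X : TTM) (Y : TM -> TTM)
    : TTM :=
  nablaH_conf phi1 u X (fun w => hpart w (Y w))
  + nablaV_conf phi2 u X (fun w => vpart w (Y w)).

Definition nablaV_conf' (phi2 : M -> R) (u : TM) (X : TTM) (Y : TM -> TTM)
    : TTM :=
  nablaV u X Y + dfun (phi2 \o tproj) u X *: Y u.

Definition Gmetric (f1 f2 f3 : M -> R) (u : TM) (X Y : TTM) : R :=
  gweighted f1 f2 u X Y + f3 (tproj u) * (mu_form u X * mu_form u Y).

Definition Ktensor (f1 f3 : M -> R) (u : TM) (X Y : TTM) : TTM :=
  let a1 := f1 (tproj u) in
  let a3 := f3 (tproj u) in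
  mu_form u Y *: ((a3 / a1) *: theta_t u X
    - (rsq u * a3 ^+ 2 / ((rsq u * a3 + a1) * a1) * Omega u X)
        *: theta_t u (canon_vert u)).

Definition Dtildetilde (phi1 phi2 f1 f3 : M -> R) (u : TM) (X : TTM)
    (Y : TM -> TTM) : TTM :=
  Dtilde phi1 phi2 u X Y + Ktensor f1 f3 u X (Y u).

End Horizontal.
End TangentGeometry.

(* Main.v *)
Require Import Defs.
From HB Require Import structures.
From mathcomp Require Import all_boot all_order all_algebra.
From mathcomp Require Import all_classical all_reals all_analysis.
From mathcomp Require Import ring.
Import Order.TTheory GRing.Theory Num.Theory.
Import numFieldNormedType.Exports.
Local Open Scope classical_set_scope.
Local Open Scope ring_scope.

(* In the preferred chart at u the tangent vector X of TM is a pair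
   (X.1, X.2) with d pi X = X.1; the vertical lift of w is (0, w), and
   X^v = (0, kappa X) where kappa X = Ds_X xi.  All tensors of the statement
   thereby become expressions in X.1, kappa X and g.  Expanding a section of
   pi^* TM in the pull-back of a local frame of M shows that Ds is metric for
   pi^* g and that kappa is the identity on vertical vectors.  Then (i) and
   (iii) follow from the Leibniz rule and
   <C_i(X,Y),Z> + <Y,C_i(X,Z)> = 2 X(phi_i) <Y,Z>, while (ii) follows from
   X(mu(Y)) = <kappa X, Y.1> + <xi, Ds_X(d pi Y)>, the tensor K being the
   solution of f1 <K_X Y, Z.1> + f3 <xi, K_X Y> mu(Z)
   = f3 <kappa X, Z.1> mu(Y). *)

Set Implicit Arguments.
Unset Strict Implicit.
Unset Printing Implicit Defensive.

Local Notation coord := Defs.coord.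

(** * Derivatives and smoothness in normed spaces *)

Section Calculus.
Context {R : realType}.
Implicit Types E F G : normedModType R.

(** ['d f x] is continuous and linear and also satisfies the first-order expansion of [h] at [x],
    because the two functions have the same germ there; uniqueness of the differential then
    identifies it with ['d h x]. *)
Lemma near_eq_differentiable E F (f h : E -> F) (x : E) :
  (\near x, f x = h x) -> differentiable f x -> differentiable h x.
Proof.
move=> fh df; have fhx : f x = h x by exact: (nbhs_singleton fh).
have cd : continuous ('d f x) by exact: diff_continuous.
have E0 : h \o shift x = cst (h x) + 'd f x +o_ 0 id.
  apply/eqaddoP => e e0.
  have /eqaddoP/(_ _ e0) H := diff_locally df.
  have fh0 : \forall y \near (0 : E), f (y + x) = h (y + x).
    by move: fh; rewrite (near_shift 0) subr0.
  apply: filterS2 H fh0 => y /= H fhy.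
  move: H; change (`|f (y + x) - (f x + 'd f x y)| <= e * `|y| ->
    `|h (y + x) - (h x + 'd f x y)| <= e * `|y|).
  by rewrite fhy fhx.
apply/diff_locallyP; have -> : 'd h x = 'd f x :> (E -> F).
  exact: diff_unique.
by split.
Qed.

Lemma derive_along_linear E F (f : E -> F) (x : E) (a : R) (u v : E) :
  differentiable f x -> 'D_(a *: u + v) f x = a *: 'D_u f x + 'D_v f x.
Proof. by move=> df; rewrite !deriveE// linearP. Qed.

Lemma derive_comp E F G (f : E -> F) (h : F -> G) (x v : E) :
  differentiable f x -> differentiable h (f x) ->
  'D_v (h \o f) x = 'D_('D_v f x) h (f x).
Proof.
move=> df dh; rewrite !deriveE//; last exact: differentiable_comp.
by rewrite diff_comp.
Qed.

Lemma derive_linear_map E F (L : {linear E -> F}) (x v : E) :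
  continuous L -> 'D_v L x = L v.
Proof.
move=> cL; rewrite deriveE; last exact: linear_differentiable.
by rewrite diff_lin.
Qed.

Lemma derive_pair E F G (f : E -> F) (h : E -> G) (x v : E) :
  differentiable f x -> differentiable h x ->
  'D_v (fun y => (f y, h y)) x = ('D_v f x, 'D_v h x).
Proof.
move=> df dh; rewrite !deriveE//; last exact: differentiable_pair.
by rewrite diff_pair.
Qed.

(** Scalar multiplication as a bilinear map of normed modules, with scalars in [R^o], so that the
    differential of a bilinear map yields the product rule. *)
Definition scale_fun E (k : R^o) (v : E) : E := k *: v.

Lemma scale_fun_bilinear E :
  bilinear_for (GRing.Scale.Law.clone _ _ *:%R _)
    (GRing.Scale.Law.clone _ _ *:%R _) (@scale_fun E).
Proof.
split=> [u'|u] a x y /=.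
- by rewrite /scale_fun scalerDl scalerA.
- by rewrite /scale_fun scalerDr !scalerA mulrC.
Qed.

HB.instance Definition _ E := bilinear_isBilinear.Build R R^o E E _ _
  (@scale_fun E) (@scale_fun_bilinear E).

Lemma differentiable_scale E F (k : E -> R^o) (f : E -> F) (x : E) :
  differentiable k x -> differentiable f x ->
  differentiable (fun y => k y *: f y) x.
Proof.
move=> dk df.
apply: (@differentiable_comp _ _ _ _ (fun y => (k y, f y))
  (fun p : R^o * F => scale_fun p.1 p.2)); first exact: differentiable_pair.
apply: (differentiable_bilin (f := @scale_fun F)).
exact: (@scale_continuous R F).
Qed.

Lemma derive_scale E F (k : E -> R^o) (f : E -> F) (x v : E) :
  differentiable k x -> differentiable f x ->
  'D_v (fun y => k y *: f y) x = 'D_v k x *: f x + k x *: 'D_v f x.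
Proof.
move=> dk df; pose h := fun p : R^o * F => scale_fun p.1 p.2.
have ch : continuous h by exact: (@scale_continuous R F).
have -> : (fun y => k y *: f y) = h \o (fun y => (k y, f y)) by [].
rewrite derive_comp; last 2 first.
- exact: differentiable_pair.
- exact: (differentiable_bilin (f := @scale_fun F)).
rewrite derive_pair// deriveE; last first.
  exact: (differentiable_bilin (f := @scale_fun F)).
by rewrite (diff_bilin (f := @scale_fun F))//= /scale_fun addrC.
Qed.

Lemma fst_linear_continuous E F : continuous (fst : E * F -> E).
Proof. by move=> p; exact: cvg_fst. Qed.

Lemma snd_linear_continuous E F : continuous (snd : E * F -> F).
Proof. by move=> p; exact: cvg_snd. Qed.

(** The difference quotients of [f \o fst] along [v] are literally those of [f] along [v.1], so no
    differentiability of [f] is involved. *)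
Lemma is_derive_fst E F G (f : E -> G) (x v : E * F) (d : G) :
  is_derive x.1 v.1 f d -> is_derive x v (f \o fst) d.
Proof. by move=> [df <-]; split. Qed.

End Calculus.

(** * Closure properties of C^k and smooth functions *)

Section Smoothness.
Context {R : realType}.
Implicit Types E F G : normedModType R.

Lemma Ck_sub E F k (U V : set E) (f : E -> F) :
  V `<=` U -> Ck k U f -> Ck k V f.
Proof.
move=> VU; elim: k f => [|k IH] f /=; first by move=> cf x /VU; exact: cf.
by case=> df Df; split=> [x /VU|v]; [exact: df|exact: IH].
Qed.

Lemma open_near_eq E F (U : set E) (f h : E -> F) :
  open U -> {in U, f =1 h} -> forall x, U x -> \near x, f x = h x.
Proof.
move=> oU fh x Ux; near=> y.
by apply: fh; rewrite inE; near: y; exact: open_nbhs_nbhs.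
Unshelve. all: by end_near. Qed.

(** As [U] is open, equality on [U] is equality of germs at each of its points, hence passes to
    directional derivatives and through the induction on [k]. *)
Lemma Ck_ext E F k (U : set E) (f h : E -> F) :
  open U -> {in U, f =1 h} -> Ck k U f -> Ck k U h.
Proof.
move=> oU; elim: k f h => [|k IH] f h fh /=.
  move=> cf x Ux; have fhx := open_near_eq oU fh Ux.
  change (h y @[y --> x] --> h x); rewrite -[h x](nbhs_singleton fhx).
  by apply: cvg_trans (cf x Ux); exact: near_eq_cvg.
case=> df Df; split=> [x Ux|v].
  exact: near_eq_differentiable (open_near_eq oU fh Ux) (df x Ux).
apply: IH (Df v) => x; rewrite inE => Ux.
exact: near_eq_derive (open_near_eq oU fh Ux).
Qed.

Lemma CkW E F k (U : set E) (f : E -> F) : Ck k.+1 U f -> Ck k U f.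
Proof.
elim: k f => [|k IH] f.
  by case=> df _ x Ux; apply: differentiable_continuous; exact: df.
by case=> df Df; split=> // v; apply: IH; exact: Df.
Qed.

Lemma Ck_cst E F k (U : set E) (c : F) : Ck k U (fun=> c : F).
Proof.
elim: k c => [|k IH] c; first by move=> x _; exact: cvg_cst.
split=> [x _|v]; first exact: differentiable_cst.
by have -> : (fun x : E => 'D_v (fun=> c) x) = (fun=> 0);
  [apply/funext => x; rewrite derive_cst|exact: IH].
Qed.

Lemma Ck_linear E F k (U : set E) (L : {linear E -> F}) :
  continuous L -> Ck k U L.
Proof.
move=> cL; case: k => [|k]; first by move=> x _; exact: cL.
split=> [x _|v]; first exact: linear_differentiable.
have -> : (fun x : E => 'D_v L x) = (fun=> L v);
  [by apply/funext => x; rewrite derive_linear_map|exact: Ck_cst].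
Qed.

Lemma Ck_comp_linear E F G k (U : set E) (L : {linear F -> G}) (f : E -> F) :
  open U -> continuous L -> Ck k U f -> Ck k U (L \o f).
Proof.
move=> oU cL; elim: k f => [|k IH] f.
  by move=> cf x Ux; apply: continuous_comp; [exact: cf|exact: cL].
case=> df Df; split=> [x Ux|v].
  by apply: differentiable_comp; [exact: df|exact: linear_differentiable].
apply: Ck_ext (IH _ (Df v)) => // x; rewrite inE => Ux /=.
rewrite derive_comp ?derive_linear_map//; first exact: df.
exact: linear_differentiable.
Qed.

Lemma CkD E F k (U : set E) (f h : E -> F) :
  open U -> Ck k U f -> Ck k U h -> Ck k U (fun x => f x + h x).
Proof.
move=> oU; elim: k f h => [|k IH] f h.
  by move=> cf ch x Ux; apply: cvgD; [exact: cf|exact: ch].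
case=> df Df [dh Dh]; split=> [x Ux|v].
  by apply: differentiableD; [exact: df|exact: dh].
apply: Ck_ext (IH _ _ (Df v) (Dh v)) => // x; rewrite inE => Ux.
by rewrite deriveD//; apply: diff_derivable; [exact: df|exact: dh].
Qed.

(** Each term of the Leibniz formula pairs a derivative of class C^k with an undifferentiated
    factor, which [CkW] lowers to class C^k for the induction. *)
Lemma Ck_scale E F k (U : set E) (c : E -> R^o) (f : E -> F) :
  open U -> Ck k U c -> Ck k U f -> Ck k U (fun x => c x *: f x).
Proof.
move=> oU; elim: k c f => [|k IH] c f.
  by move=> cc cf x Ux; apply: cvgZ; [exact: cc|exact: cf].
move=> Cc Cf; case: (Cc) => dc Dc; case: (Cf) => df Df; split=> [x Ux|v].
  by apply: differentiable_scale; [exact: dc|exact: df].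
apply: (@Ck_ext _ _ _ _ (fun x => 'D_v c x *: f x + c x *: 'D_v f x)) => //.
  by move=> x; rewrite inE => Ux; rewrite derive_scale//; [exact: dc|exact: df].
apply: CkD => //; first exact: IH (Dc v) (CkW Cf).
exact: IH (CkW Cc) (Df v).
Qed.

Lemma Ck_pair E F G k (U : set E) (f : E -> F) (h : E -> G) :
  open U -> Ck k U f -> Ck k U h -> Ck k U (fun x => (f x, h x)).
Proof.
move=> oU; elim: k f h => [|k IH] f h.
  by move=> cf ch x Ux; apply: cvg_pair; [exact: cf|exact: ch].
case=> df Df [dh Dh]; split=> [x Ux|v].
  by apply: differentiable_pair; [exact: df|exact: dh].
apply: Ck_ext (IH _ _ (Df v) (Dh v)) => // x; rewrite inE => Ux.
by rewrite derive_pair//; [exact: df|exact: dh].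
Qed.

Lemma smooth_at_near E F (f : E -> F) x :
  smooth_at f x -> \forall y \near x, smooth_at f y.
Proof.
move=> [U [oU Ux Cf]]; near=> y; exists U; split=> //.
by near: y; exact: open_nbhs_nbhs.
Unshelve. all: by end_near. Qed.

Lemma smooth_at_differentiable E F (f : E -> F) x :
  smooth_at f x -> differentiable f x.
Proof. by move=> [U [_ Ux /(_ 1%N)[df _]]]; exact: df. Qed.

Lemma smooth_at_continuous E F (f : E -> F) x :
  smooth_at f x -> {for x, continuous f}.
Proof. by move/smooth_at_differentiable/differentiable_continuous. Qed.

Lemma smooth_at_ext E F (f h : E -> F) x :
  (\near x, f x = h x) -> smooth_at f x -> smooth_at h x.
Proof.
move=> fh; move: (fh); rewrite -nbhs_nearE nbhsE => -[V [oV Vx] Vfh].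
move=> [U [oU Ux Cf]].
exists (U `&` V); split; [exact: openI|by split|move=> k].
apply: (@Ck_ext _ _ _ _ f); first exact: openI.
  by move=> y; rewrite inE => -[_ /Vfh].
by apply: Ck_sub (Cf k); exact: subIsetl.
Qed.

Lemma smooth_at_derive E F (f : E -> F) x v :
  smooth_at f x -> smooth_at (fun y => 'D_v f y) x.
Proof.
by move=> [U [oU Ux Cf]]; exists U; split=> // k; have [_] := Cf k.+1; apply.
Qed.

Lemma smooth_at_cst E F (c : F) (x : E) : smooth_at (fun=> c) x.
Proof. by exists setT; split=> [||k]; [exact: openT| |exact: Ck_cst]. Qed.

Lemma smooth_at_linear E F (L : {linear E -> F}) x :
  continuous L -> smooth_at L x.
Proof.
by move=> cL; exists setT; split=> [||k]; [exact: openT| |exact: Ck_linear].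
Qed.

Lemma smooth_at_comp_linear E F G (L : {linear F -> G}) (f : E -> F) x :
  continuous L -> smooth_at f x -> smooth_at (L \o f) x.
Proof.
by move=> cL [U [oU Ux Cf]]; exists U; split=> // k; exact: Ck_comp_linear.
Qed.

(** Passage to the intersection of the two open sets, shared by sums, products and pairs. *)
Lemma smooth_at2 E F G (H : normedModType R) (f : E -> F) (h : E -> G) (o : F -> G -> H) x :
  (forall k U, open U -> Ck k U f -> Ck k U h -> Ck k U (fun x => o (f x) (h x))) ->
  smooth_at f x -> smooth_at h x -> smooth_at (fun x => o (f x) (h x)) x.
Proof.
move=> C [U [oU Ux Cf]] [V [oV Vx Ch]].
exists (U `&` V); split; [exact: openI|by split|move=> k].
apply: C; first exact: openI.
  by apply: Ck_sub (Cf k); exact: subIsetl.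
by apply: Ck_sub (Ch k); exact: subIsetr.
Qed.

Lemma smooth_atD E F (f h : E -> F) x :
  smooth_at f x -> smooth_at h x -> smooth_at (fun x => f x + h x) x.
Proof. by apply: smooth_at2 => k U oU; exact: CkD. Qed.

Lemma smooth_at_scale E F (c : E -> R^o) (f : E -> F) x :
  smooth_at c x -> smooth_at f x -> smooth_at (fun x => c x *: f x) x.
Proof. by apply: smooth_at2 => k U oU; exact: Ck_scale. Qed.

Lemma smooth_at_pair E F G (f : E -> F) (h : E -> G) x :
  smooth_at f x -> smooth_at h x -> smooth_at (fun x => (f x, h x)) x.
Proof. by apply: smooth_at2 => k U oU; exact: Ck_pair. Qed.

End Smoothness.

(** * Charts and smooth sections *)

Lemma near_fst (E F : topologicalType) (x : E * F) (P : set E) :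
  (\forall y \near x.1, P y) -> \forall y \near x, P y.1.
Proof. by move=> nP; exact: (cvg_fst nP). Qed.


Section Atlas.
Context {R : realType} {E : normedModType R} (M : charted E).

(** Components in the chart [a] of a vector tangent at [q]. Its inverse [chart_vector] gives, for
    fixed [e], the local vector field with constant components [e] in that chart. *)
Definition read_vector (a : chart M) (q : M) (v : E) : E :=
  'D_v (coord a \o pparam q) (pcoord q q).

Definition chart_vector (a : chart M) (e : E) (q : M) : E :=
  'D_e (pcoord q \o param a) (coord a q).

Context (hM : is_manifold M).
Implicit Types (a b c : chart M) (p q : M).

Lemma pref_dom p : dom (pref p) p.
Proof. by case: hM. Qed.

Lemma coordK a p : dom a p -> param a (coord a p) = p.
Proof. by case: hM => _ + _ _ _; apply. Qed.

Lemma transition_smooth a b p : dom a p -> dom b p ->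
  smooth_at (coord b \o param a) (coord a p).
Proof. by case: hM => _ _ /(_ a b)[_ +] _ _; apply. Qed.

Lemma transition_differentiable a b p : dom a p -> dom b p ->
  differentiable (coord b \o param a) (coord a p).
Proof. by move=> ap bp; exact/smooth_at_differentiable/transition_smooth. Qed.

(** The image of the overlap of two charts is open, so points near [coord a p] are coordinates of
    points of the overlap; only for such points is [param] an inverse of [coord]. *)
Lemma near_chart a b p : dom a p -> dom b p ->
  \forall x \near coord a p,
    [/\ dom a (param a x), dom b (param a x) & coord a (param a x) = x].
Proof.
move=> ap bp; case: hM => _ _ /(_ a b)[oab _] _ _.
have : nbhs (coord a p) (coord a @` (dom a `&` dom b)).
  by apply: open_nbhs_nbhs; split=> //; exists p.
apply: filterS => x [q [aq bq] <-].
by rewrite coordK.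
Qed.

(** Cocycle identity of the tangent bundle: the chain rule applied to [coord c \o param a], which
    factors through the chart [b] near the point. *)
Lemma derive_transition a b c p (v : E) : dom a p -> dom b p -> dom c p ->
  'D_('D_v (coord b \o param a) (coord a p)) (coord c \o param b) (coord b p) =
  'D_v (coord c \o param a) (coord a p).
Proof.
move=> ap bp cp; have Ep : coord b p = (coord b \o param a) (coord a p).
  by rewrite /= coordK.
rewrite Ep -derive_comp.
- apply: near_eq_derive; have := near_chart ap bp.
  by apply: filterS => x [_ bx _] /=; rewrite coordK.
- exact: transition_differentiable.
- by rewrite -Ep; exact: transition_differentiable.
Qed.

Lemma derive_transition_id a p (v : E) : dom a p ->
  'D_v (coord a \o param a) (coord a p) = v.
Proof.
move=> ap; rewrite -[RHS](@derive_id R E (coord a p) v).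
apply: near_eq_derive; have := near_chart ap ap.
by apply: filterS => x [].
Qed.

Lemma chart_vectorK a q e : dom a q -> read_vector a q (chart_vector a e q) = e.
Proof.
move=> aq; rewrite /read_vector /chart_vector /pcoord /pparam.
rewrite derive_transition//; last exact: pref_dom.
exact: derive_transition_id.
Qed.

Lemma read_vectorK a q v : dom a q -> chart_vector a (read_vector a q v) q = v.
Proof.
move=> aq; rewrite /read_vector /chart_vector /pcoord /pparam.
have dq := pref_dom q.
by rewrite derive_transition// derive_transition_id.
Qed.

Lemma read_vector_linear a q k u v : dom a q ->
  read_vector a q (k *: u + v) = k *: read_vector a q u + read_vector a q v.
Proof.
move=> aq; apply: derive_along_linear.
by apply: transition_differentiable => //; exact: pref_dom.
Qed.

Lemma read_vectorD a q u v : dom a q ->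
  read_vector a q (u + v) = read_vector a q u + read_vector a q v.
Proof. by move=> aq; rewrite -[u]scale1r read_vector_linear// !scale1r. Qed.

Lemma read_vector0 a q : read_vector a q 0 = 0.
Proof. exact: derive0. Qed.

Lemma read_vectorZ a q k u : dom a q ->
  read_vector a q (k *: u) = k *: read_vector a q u.
Proof.
by move=> aq; rewrite -[k *: u]addr0 read_vector_linear// read_vector0 addr0.
Qed.

Lemma read_vector_pref p v : read_vector (pref p) p v = v.
Proof. by apply: derive_transition_id; exact: pref_dom. Qed.

Lemma chart_vector_pref p e : chart_vector (pref p) e p = e.
Proof. by apply: derive_transition_id; exact: pref_dom. Qed.

Local Notation TM := (tangent M).

Lemma tangent_coordE a (u : TM) :
  coord (c := TM) a u = (coord a u.1, read_vector a u.1 u.2).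
Proof. by []. Qed.

Lemma tangent_coordK a (u : TM) : dom a u.1 ->
  param (c := TM) a (coord (c := TM) a u) = u.
Proof.
case: u => q v /= aq; rewrite coordK//; congr (_, _).
exact: read_vectorK.
Qed.

Lemma near_tangent_dom (u : TM) : \forall x \near pcoord u u,
  dom (pref u.1) (pparam u x).1 /\ coord (pref u.1) (pparam u x).1 = x.1.
Proof.
have du := pref_dom u.1.
apply: (near_fst (P := fun y => dom (pref u.1) (param (pref u.1) y) /\
  coord (pref u.1) (param (pref u.1) y) = y)).
by have := near_chart du du; apply: filterS => x [].
Qed.

Lemma near_pparamK (u : TM) :
  \forall x \near pcoord u u, pcoord u (pparam u x) = x.
Proof.
apply: filterS (near_tangent_dom u) => x [dx cx].
rewrite [pcoord u _]tangent_coordE cx.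
have -> : (pparam u x).2 = chart_vector (pref u.1) x.2 (pparam u x).1.
  by rewrite /chart_vector cx.
by rewrite chart_vectorK//; case: x {dx cx}.
Qed.

Lemma pparam_pcoord (u : TM) : pparam u (pcoord u u) = u.
Proof. by apply: tangent_coordK; exact: pref_dom. Qed.

(** * Smooth sections along a map, read in a fixed chart of the target *)

Section Sections.
Context {G : normedModType R} (N : charted G) (f : N -> M) (p : N).
Context (hp : pparam p (pcoord p p) = p) (hf : smooth_map f p).
Implicit Types s t : N -> E.

Definition read_section s (q : N) : E := read_vector (pref (f p)) (f q) (s q).

Lemma smooth_section_read s : smooth_section f s p ->
  smooth_at (read_section s \o pparam p) (pcoord p p).
Proof.
case=> _ /(smooth_at_comp_linear (@snd_linear_continuous _ _ _)); exact.
Qed.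

Lemma nearby_dom :
  \forall x \near pcoord p p, dom (pref (f p)) (f (pparam p x)).
Proof.
apply: (hf.1 (fun y => dom (pref (f p)) y)).
have := near_chart (pref_dom (f p)) (pref_dom (f p)).
by apply: filterS => x [].
Qed.

(** The converse of [smooth_section_read]: smoothness of the components suffices, since [f] itself
    is already smooth. *)
Lemma smooth_sectionI s :
  smooth_at (read_section s \o pparam p) (pcoord p p) -> smooth_section f s p.
Proof.
move=> hs; pose a := pref (f p).
have sF : smooth_at (fun x => (coord a (f (pparam p x)),
    read_section s (pparam p x)) : E * E) (pcoord p p).
  by apply: smooth_at_pair => //; exact: hf.2.
split=> // P nP.
(* [smooth_map] also demands continuity for the atlas topology. It comes from continuity of the
   local expression, after which [tangent_coordK] recovers the section from its coordinates. *)
have cF : (fun x => (coord a (f (pparam p x)),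
    read_section s (pparam p x)) : E * E) x @[x --> pcoord p p] -->
    ((coord a (f p), read_section s p) : E * E).
  by have := smooth_at_continuous sF; rewrite /prop_for /continuous_at hp.
apply: filterS2 nearby_dom (cF _ nP) => x /= ax.
have /= := tangent_coordK (u := (f (pparam p x), s (pparam p x))) ax.
by rewrite /pparam /= => ->.
Qed.

Lemma smooth_sectionD s t : smooth_section f s p -> smooth_section f t p ->
  smooth_section f (fun q : N => s q + t q) p.
Proof.
move=> /smooth_section_read hs /smooth_section_read ht; apply: smooth_sectionI.
apply: smooth_at_ext (smooth_atD hs ht).
by apply: filterS nearby_dom => x ax /=; rewrite /read_section read_vectorD.
Qed.

Lemma smooth_sectionZ (h : N -> R) s : smooth_fun h p ->
  smooth_section f s p -> smooth_section f (fun q : N => h q *: s q) p.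
Proof.
move=> sh /smooth_section_read hs; apply: smooth_sectionI.
apply: smooth_at_ext (smooth_at_scale sh hs).
by apply: filterS nearby_dom => x ax /=; rewrite /read_section read_vectorZ.
Qed.

Lemma smooth_section0 : smooth_section f (fun=> 0) p.
Proof.
apply: smooth_sectionI; apply: smooth_at_ext (smooth_at_cst 0 _).
by apply: nearW => x; rewrite /= /read_section read_vector0.
Qed.

(** Near [p] the components of this section are constantly [e]. *)
Lemma smooth_chart_vector e :
  smooth_section f (chart_vector (pref (f p)) e \o f) p.
Proof.
apply: smooth_sectionI; apply: smooth_at_ext (smooth_at_cst e _).
by apply: filterS nearby_dom => x ax /=; rewrite /read_section chart_vectorK.
Qed.

End Sections.

Lemma smooth_id (p : M) : smooth_map (fun q : M => q) p.
Proof.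
split=> //; apply: transition_smooth; exact: pref_dom.
Qed.

Lemma smooth_tproj (u : TM) : smooth_map (@tproj _ _ M) u.
Proof.
split=> [P nP|]; first exact: (near_fst (x := pcoord u u) nP).
apply: smooth_at_ext (smooth_at_linear _ (@fst_linear_continuous _ _ _)).
by apply: filterS (near_tangent_dom u) => x [].
Qed.

Lemma dprojE (u : TM) X : dproj u X = X.1.
Proof.
rewrite -[RHS](derive_linear_map (pcoord u u) X (@fst_linear_continuous _ E E)).
apply: near_eq_derive.
by apply: filterS (near_tangent_dom u) => x [].
Qed.

(** The preferred chart at [u] is the one preferred at its base point, so it reads vectors of the
    fibre through [u] unchanged. *)
Lemma vliftE (u : TM) w : vlift u w = (0, w).
Proof.
have -> : vlift u w = 'D_w (fun v : E => (pcoord u.1 u.1, v)) u.2.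
  apply: near_eq_derive; apply: nearW => v.
  by rewrite /pcoord tangent_coordE read_vector_pref.
rewrite derive_pair ?derive_cst ?derive_id//.
Qed.

Lemma vdropE (u : TM) w : vdrop u (0, w) = w.
Proof.
rewrite /vdrop; have : [set w' | vlift u w' = (0, w)] w by exact: vliftE.
by move=> /(xgetI 0) /=; rewrite vliftE => -[].
Qed.

Lemma verticalE (u : TM) X : vertical u X = (X.1 = 0).
Proof. by rewrite /vertical /= dprojE. Qed.

(** Seen as a map from TM to TM, the tautological section is the identity. *)
Lemma smooth_tautological (u : TM) :
  smooth_section (@tproj _ _ M) (@tautological _ _ M) u.
Proof.
rewrite /smooth_section /tproj /tautological.
have -> : (fun q : TM => (q.1, q.2)) = (fun q : TM => q).
  by apply/funext => -[].
split=> //; apply: smooth_at_ext (smooth_at_linear (L := idfun) _ _).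
  by apply: filterS (near_pparamK u).
by move=> x; exact: cvg_id.
Qed.

End Atlas.

(** * Coordinates of row vectors and differentiability of the tangent map *)

Section RowVectors.
Context {R : realType} {m : nat}.
Local Notation E := 'rV[R]_m.

Definition row_coord (i : 'I_m) (v : E) : R^o := v 0 i.

Lemma row_coord_linear i : linear (row_coord i).
Proof. by move=> a u v; rewrite /row_coord !mxE. Qed.

HB.instance Definition _ i :=
  GRing.isLinear.Build R E R^o _ (row_coord i) (row_coord_linear i).

Lemma row_coord_continuous i : continuous (row_coord i).
Proof. exact: coord_continuous. Qed.

Lemma derive_row (F : normedModType R) (f : E -> F) (x v : E) :
  differentiable f x ->
  'D_v f x = \sum_i row_coord i v *: 'D_(delta_mx 0 i) f x.
Proof.
move=> df; rewrite deriveE// {1}[v]row_sum_delta linear_sum.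
by apply: eq_bigr => i _; rewrite linearZ deriveE.
Qed.

(** Finite dimension enters here: near [x] the tangent map is a finite sum of coordinates of the
    vector times partial derivatives at the base point, and each such product is differentiable. *)
Lemma differentiable_tangent_map (F : normedModType R) (f : E -> F)
    (x : E * E) : smooth_at f x.1 ->
  differentiable (fun y : E * E => 'D_(y.2) f y.1) x.
Proof.
move=> sf; pose h := fun (i : 'I_m) (y : E * E) =>
  (row_coord i \o snd) y *: ((fun z => 'D_(delta_mx 0 i) f z) \o fst) y.
have : differentiable (\sum_(i < m) h i) x.
  apply: differentiable_sum => i; apply: differentiable_scale.
    apply: differentiable_comp.
      exact/linear_differentiable/snd_linear_continuous.
    exact/linear_differentiable/row_coord_continuous.
  apply: differentiable_comp.
    exact/linear_differentiable/fst_linear_continuous.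
  exact/smooth_at_differentiable/smooth_at_derive.
apply: near_eq_differentiable.
have := near_fst (smooth_at_near sf); apply: filterS => y sfy.
rewrite fct_sumE derive_row//; exact: smooth_at_differentiable.
Qed.

End RowVectors.

(** * Changes of chart of TM and base components of vector fields on TM *)

Section TangentTransition.
Context {R : realType} {m : nat}.
Local Notation E := 'rV[R]_m.
Context (M : charted E) (hM : is_manifold M).
Local Notation TM := (tangent M).

(** A change of chart of TM is [(phi, d phi)] with [phi] the change of chart of M; the first
    component of its derivative involves [phi] and [X.1] alone. *)
Lemma read_vector_fst (a : chart M) (u : TM) (X : E * E) : dom a u.1 ->
  (read_vector (M := TM) a u X).1 = read_vector a u.1 X.1.
Proof.
move=> au; pose b := pref u.1; pose phi := coord a \o param b.
have bu : dom b u.1 by exact: pref_dom.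
have sphi : smooth_at phi (pcoord u u).1 by exact: transition_smooth.
have dfst : differentiable (fun x : E * E => phi x.1) (pcoord u u).
  apply: (differentiable_comp (f := fst) (g := phi)).
    exact/linear_differentiable/fst_linear_continuous.
  exact: smooth_at_differentiable.
have -> : read_vector (M := TM) a u X =
    'D_X (fun x : E * E => (phi x.1, 'D_(x.2) phi x.1)) (pcoord u u).
  apply: near_eq_derive.
  have := near_fst (x := pcoord u u) (near_chart hM bu au).
  apply: filterS => x [bx ax cx].
  (* The charts of TM pass through the chart preferred at the nearby point; the cocycle identity
     removes that intermediate chart. *)
  have := derive_transition hM x.2 bx (pref_dom hM (param b x.1)) ax.
  by rewrite cx => <-.
rewrite derive_pair//=; last exact: differentiable_tangent_map.
Qed.

Lemma smooth_section_fst (Y : TM -> E * E) (u : TM) : smooth_field Y u ->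
  smooth_section (@tproj _ _ M) (fun w => (Y w).1) u.
Proof.
move=> /smooth_section_read sY; apply: smooth_sectionI => //.
- exact: pparam_pcoord.
- exact: smooth_tproj.
apply: smooth_at_ext (smooth_at_comp_linear (@fst_linear_continuous _ _ _) sY).
have := near_tangent_dom hM u; apply: filterS => x [ax _].
exact: read_vector_fst.
Qed.

End TangentTransition.

(** * Metric compatibility of the pull-back connection *)

Section MetricAlgebra.
Context {R : realType} {E : normedModType R} {M : charted E}.
Context (g : M -> E -> E -> R) (hg : is_riemannian g) (p : M).
Implicit Types v w : E.

Lemma metricC v w : g p v w = g p w v.
Proof. by case: hg. Qed.

Lemma metricDl v1 v2 w : g p (v1 + v2) w = g p v1 w + g p v2 w.
Proof.
by case: hg => lin _ _ _; rewrite -[v1]scale1r lin mul1r scale1r.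
Qed.

Lemma metric0l w : g p 0 w = 0.
Proof. by apply: (addrI (g p 0 w)); rewrite -metricDl !addr0. Qed.

Lemma metricZl a v w : g p (a *: v) w = a * g p v w.
Proof.
by case: hg => lin _ _ _; rewrite -[a *: v]addr0 lin metric0l addr0.
Qed.

Lemma metricDr v w1 w2 : g p v (w1 + w2) = g p v w1 + g p v w2.
Proof. by rewrite metricC metricDl !(metricC v). Qed.

Lemma metricZr a v w : g p v (a *: w) = a * g p v w.
Proof. by rewrite metricC metricZl metricC. Qed.

Lemma metricNl v w : g p (- v) w = - g p v w.
Proof. by rewrite -scaleN1r metricZl mulN1r. Qed.

Lemma metricNr v w : g p v (- w) = - g p v w.
Proof. by rewrite metricC metricNl metricC. Qed.

Lemma metric_suml (I : Type) (r : seq I) (f : I -> E) w :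
  g p (\sum_(i <- r) f i) w = \sum_(i <- r) g p (f i) w.
Proof.
by elim/big_rec2: _ => [|i x y _ <-]; rewrite ?metric0l// metricDl.
Qed.

Lemma metric_sumr (I : Type) (r : seq I) (f : I -> E) v :
  g p v (\sum_(i <- r) f i) = \sum_(i <- r) g p v (f i).
Proof. by rewrite metricC metric_suml; apply: eq_bigr => i _; exact: metricC. Qed.

Lemma metric_eq0 v : g p v v = 0 -> v = 0.
Proof.
move=> gv; apply/eqP/negPn/negP => v0.
by case: hg => _ _ /(_ p _ v0) + _; rewrite gv ltxx.
Qed.

End MetricAlgebra.

(** * Covariant derivatives of finite sums *)

Section ConnectionSum.
Context {R : realType} {E F : normedModType R} {N : charted E} {M : charted F}.
Context (hM : is_manifold M) (f : N -> M) (p : N).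
Context (hp : pparam p (pcoord p p) = p) (hf : smooth_map f p).
Context (D : N -> E -> (N -> F) -> F) (hD : is_connection f D).

(** Smoothness and additivity are proved together, because additivity of a connection is only
    available for smooth summands and the induction needs it for the tail. *)
Lemma connection_sum (I : Type) (r : seq I) (s : I -> N -> F) X :
  (forall i, smooth_section f (s i) p) ->
  smooth_section f (fun q => \sum_(i <- r) s i q) p /\
  D p X (fun q => \sum_(i <- r) s i q) = \sum_(i <- r) D p X (s i).
Proof.
case: hD => _ DD _ _ _ hs.
have s0 := smooth_section0 hM hp hf.
have D0 : D p X (fun=> 0) = 0.
  by apply: (addrI (D p X (fun=> 0))); rewrite -DD// !addr0.
elim: r => [|i r [IHs IHD]].
  rewrite big_nil.
  have -> : (fun q => \sum_(i <- [::]) s i q) = (fun=> 0).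
    by apply/funext => q; rewrite big_nil.
  by split.
have -> : (fun q => \sum_(j <- i :: r) s j q) =
    (fun q => s i q + \sum_(j <- r) s j q).
  by apply/funext => q; rewrite big_cons.
split; first exact: smooth_sectionD.
by rewrite DD// big_cons IHD.
Qed.

End ConnectionSum.

(** * The pull-back connection in a local frame *)

Section LocalFrame.
Context {R : realType} {m : nat}.
Local Notation E := 'rV[R]_m.
Context (M : charted E) (hM : is_manifold M).
Local Notation TM := (tangent M).
Local Notation proj := (@tproj _ _ M).
Context (D : M -> E -> (M -> E) -> E) (Ds : TM -> E * E -> (TM -> E) -> E).
Context (hDs : is_pullback proj D Ds) (u : TM).
Implicit Types (s t : TM -> E) (X : E * E).

(** The coordinate vector fields of the chart preferred at [u.1], which form a frame over the domain
    of that chart. *)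
Definition frame (i : 'I_m) : M -> E :=
  chart_vector (pref u.1) (delta_mx 0 i).

Definition coefficient s (i : 'I_m) (w : TM) : R^o :=
  row_coord i (read_section proj u s w).

Lemma smooth_frame i : smooth_field (frame i) u.1.
Proof.
apply: smooth_chart_vector => //; last exact: smooth_id.
by apply: coordK => //; exact: pref_dom.
Qed.

Lemma frame_at i : frame i u.1 = delta_mx 0 i.
Proof. exact: chart_vector_pref. Qed.

Lemma section_decomposition s (w : TM) : dom (pref u.1) w.1 ->
  s w = \sum_i coefficient s i w *: frame i w.1.
Proof.
move=> aw; rewrite -[LHS](read_vectorK hM _ aw) /chart_vector.
rewrite derive_row//; apply: transition_differentiable => //.
exact: pref_dom.
Qed.

Lemma smooth_coefficient s i : smooth_section proj s u ->
  smooth_fun (coefficient s i) u.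
Proof.
move=> /smooth_section_read; apply: smooth_at_comp_linear.
exact: row_coord_continuous.
Qed.

Lemma smooth_frame_pullback i : smooth_section proj (frame i \o proj) u.
Proof.
apply: smooth_chart_vector => //; first exact: pparam_pcoord.
exact: smooth_tproj.
Qed.

(** A pull-back connection is prescribed only on pulled-back fields; the Leibniz rule in a
    pulled-back frame extends this to every smooth section. *)
Lemma pullback_expansion s X : smooth_section proj s u ->
  Ds u X s = \sum_i (dfun (coefficient s i) u X *: delta_mx 0 i
    + coefficient s i u *: D u.1 X.1 (frame i)).
Proof.
move=> hs; case: hDs => hC hpull; case: (hC) => _ _ DZ Dloc _.
(* The decomposition holds only over the chart domain, so locality of the connection is what allows
   the substitution. *)
rewrite (Dloc _ _ _ (fun w => \sum_i coefficient s i w *: frame i w.1))//.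
  have hZ i : smooth_section proj
      (fun w => coefficient s i w *: (frame i \o proj) w) u.
    exact: (smooth_sectionZ hM (pparam_pcoord hM u) (smooth_tproj hM u)
      (smooth_coefficient i hs) (smooth_frame_pullback i)).
  have [_ ->] := connection_sum hM (pparam_pcoord hM u) (smooth_tproj hM u) hC
    (index_enum _) X hZ.
  apply: eq_bigr => i _; rewrite DZ; last 2 first.
  - exact: smooth_coefficient.
  - exact: smooth_frame_pullback.
  rewrite hpull; last exact: smooth_frame.
  by rewrite [dmap _ _ _]dprojE// [(frame i \o proj) u]frame_at.
by have := near_tangent_dom hM u; apply: filterS => x [ax _];
  exact: section_decomposition.
Qed.

Lemma derive_coefficient_tautological i X :
  dfun (coefficient (@tautological _ _ M) i) u X = row_coord i X.2.
Proof.
have -> : row_coord i X.2 = 'D_X (row_coord i \o snd) (pcoord u u).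
  rewrite derive_comp ?derive_linear_map//.
  - exact: snd_linear_continuous.
  - exact: row_coord_continuous.
  - exact/linear_differentiable/snd_linear_continuous.
  - exact/linear_differentiable/row_coord_continuous.
(* The coefficients of the tautological section are the fibre coordinates in the chart of TM at [u],
   and this chart inverts [pparam u] near the point. *)
apply: near_eq_derive; apply: filterS (near_pparamK hM u) => x ux.
suff -> : (row_coord i \o snd) x = row_coord i (pcoord u (pparam u x)).2 by [].
by rewrite ux.
Qed.

(** A vertical direction has base component 0, so the terms in [D] of the expansion vanish and only
    the derivatives of the fibre coordinates survive. *)
Lemma pullback_tautological_vertical w (hD : linear_connection D) :
  Ds u (0, w) (@tautological _ _ M) = w.
Proof.
rewrite pullback_expansion; last exact: smooth_tautological.
rewrite [RHS]row_sum_delta; apply: eq_bigr => i _.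
rewrite derive_coefficient_tautological /=.
have D0 : D u.1 0 (frame i) = 0.
  case: hD => lin _ _ _ _; have := lin u.1 1 0 0 (frame i) (smooth_frame i).
  by rewrite !scale1r addr0 => /esym/(canRL (addrK _)); rewrite subrr.
by rewrite D0 scaler0 addr0.
Qed.

Context (g : M -> E -> E -> R) (hg : is_riemannian g).
Context (hDg : forall p : M, parallel_at D g p).

(** With [S i] and [T j] the coefficients of the two sections, the product is the sum of
    [S i * T j * <e_i, e_j>]. The product rule, with parallelism of [g] on M for the frame, agrees
    term by term with [pullback_expansion]. *)
Lemma pullback_metric s t X :
  smooth_section proj s u -> smooth_section proj t u ->
  is_derive (pcoord u u) X
    ((fun w : TM => g w.1 (s w) (t w)) \o pparam u : E * E -> R^o)
    (g u.1 (Ds u X s) (t u) + g u.1 (s u) (Ds u X t)).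
Proof.
move=> hs ht.
pose S i := coefficient s i \o pparam u : E * E -> R^o.
pose T i := coefficient t i \o pparam u : E * E -> R^o.
pose B i j := ((fun q : M => g q (frame i q) (frame j q)) \o pparam u.1)
  \o fst : E * E -> R^o.
pose A i := D u.1 X.1 (frame i); pose e i : E := delta_mx 0 i.
have Su i : S i (pcoord u u) = coefficient s i u.
  exact: (congr1 (fun w => coefficient s i w) (pparam_pcoord hM u)).
have Tu i : T i (pcoord u u) = coefficient t i u.
  exact: (congr1 (fun w => coefficient t i w) (pparam_pcoord hM u)).
have Bu i j : B i j (pcoord u u) = g u.1 (e i) (e j).
  have pu : pparam u.1 (pcoord u u).1 = u.1 by apply: coordK => //; exact: pref_dom.
  by rewrite /B /= pu !frame_at.
have dS i : is_derive (pcoord u u) X (S i) (dfun (coefficient s i) u X).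
  apply: derivableP; apply/diff_derivable/smooth_at_differentiable.
  exact: (smooth_coefficient i hs).
have dT i : is_derive (pcoord u u) X (T i) (dfun (coefficient t i) u X).
  apply: derivableP; apply/diff_derivable/smooth_at_differentiable.
  exact: (smooth_coefficient i ht).
have dB i j : is_derive (pcoord u u) X (B i j)
    (g u.1 (A i) (e j) + g u.1 (e i) (A j)).
  apply: is_derive_fst.
  have nT (Y : M -> E) : nearby u.1 (fun q => [set: E] (Y q)).
    exact: (filterS (P := setT) (fun _ _ => I) filterT).
  have := hDg X.1 (smooth_frame i) (smooth_frame j) (nT _) (nT _).
  by rewrite !frame_at.
have dF : is_derive (pcoord u u) X
    (\sum_(i < m) \sum_(j < m) S i * T j * B i j)
    (\sum_(i < m) \sum_(j < m)
      (coefficient s i u * coefficient t j u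
         * (g u.1 (A i) (e j) + g u.1 (e i) (A j))
       + g u.1 (e i) (e j) * (coefficient s i u * dfun (coefficient t j) u X
           + coefficient t j u * dfun (coefficient s i) u X))).
  apply: is_derive_sum => i; apply: is_derive_sum => j.
  apply: (is_derive_eq (is_deriveM (is_deriveM (dS i) (dT j)) (dB i j))).
  change (S i (pcoord u u) * T j (pcoord u u)
      * (g u.1 (A i) (e j) + g u.1 (e i) (A j))
    + B i j (pcoord u u) * (S i (pcoord u u) * dfun (coefficient t j) u X
      + T j (pcoord u u) * dfun (coefficient s i) u X) =
    coefficient s i u * coefficient t j u
      * (g u.1 (A i) (e j) + g u.1 (e i) (A j))
    + g u.1 (e i) (e j) * (coefficient s i u * dfun (coefficient t j) u X
      + coefficient t j u * dfun (coefficient s i) u X)).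
  by rewrite Su Tu Bu.
(* The double sum represents [g(s,t)] only near [u], which is enough for the derivative. *)
have := near_eq_is_derive _ dF; move=> /(_ ((fun w : TM => g w.1 (s w) (t w))
  \o pparam u)) H.
apply: (is_derive_eq (H _)) => {H}.
  have := near_tangent_dom hM u; apply: filterS => x [ax _].
  rewrite fct_sumE /= (section_decomposition s ax) (section_decomposition t ax).
  rewrite metric_suml//; apply: eq_bigr => i _.
  rewrite fct_sumE metric_sumr//; apply: eq_bigr => j _.
  by rewrite metricZl// metricZr// mulrA.
have Et : t u = \sum_i coefficient t i u *: e i.
  rewrite (section_decomposition t (pref_dom hM u.1)).
  by apply: eq_bigr => i _; rewrite frame_at.
have Es : s u = \sum_i coefficient s i u *: e i.
  rewrite (section_decomposition s (pref_dom hM u.1)).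
  by apply: eq_bigr => i _; rewrite frame_at.
rewrite !pullback_expansion// Es Et.
rewrite !metric_suml// -big_split; apply: eq_bigr => i _ /=.
rewrite !metric_sumr// -big_split; apply: eq_bigr => j _ /=.
rewrite !(metricDl hg, metricDr hg, metricZl hg, metricZr hg).
rewrite -/(A i) -/(A j) -/(e i) -/(e j).
move: (g _ _ _) (g _ _ _) (g _ _ _) (coefficient s i u) (coefficient t j u)
  (dfun _ _ _) (dfun _ _ _) => gA gA' ge a b da db.
ring.
Qed.

End LocalFrame.

(** * The horizontal-vertical splitting *)

Section Gradient.
Context {R : realType} {m : nat}.
Local Notation E := 'rV[R]_m.
Context (M : charted E) (g : M -> E -> E -> R) (hg : is_riemannian g).
Context (phi : M -> R) (p : M) (hphi : smooth_fun phi p).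

(** Riesz representation in finite dimension: the Gram matrix of the standard basis is invertible by
    positivity, and its inverse applied to the values of [l] gives the vector. This makes the [xget]
    in [gradient] meaningful. *)
Lemma riesz_metric (l : E -> R^o) :
  (forall v, l v = \sum_i v 0 i * l (delta_mx 0 i)) ->
  exists v, forall w, g p v w = l w.
Proof.
move=> hl; pose G : 'M[R]_m := \matrix_(i, j) g p (delta_mx 0 i) (delta_mx 0 j).
have GE (v : E) j : (v *m G) 0 j = g p v (delta_mx 0 j).
  rewrite {2}[v]row_sum_delta metric_suml// mxE; apply: eq_bigr => i _.
  by rewrite mxE metricZl.
have gE (v w : E) : g p v w = \sum_j w 0 j * (v *m G) 0 j.
  rewrite {1}[w]row_sum_delta metric_sumr//; apply: eq_bigr => j _.
  by rewrite metricZr// GE.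
have uG : G \in unitmx.
  rewrite -row_free_unit; apply: inj_row_free => v vG.
  apply: (metric_eq0 hg (p := p)); rewrite gE vG.
  by apply: big1 => j _; rewrite mxE mulr0.
exists (\row_j l (delta_mx 0 j) *m invmx G) => w.
by rewrite gE hl mulmxKV//; apply: eq_bigr => j _; rewrite mxE.
Qed.

Lemma gradientE w : g p (gradient g phi p) w = dfun phi p w.
Proof.
have df : differentiable (phi \o pparam p : E -> R^o) (pcoord p p).
  exact: smooth_at_differentiable.
have [v hv] : exists v, forall w, g p v w = dfun phi p w.
  apply: (riesz_metric (l := dfun phi p)) => v.
  by rewrite [LHS]derive_row.
exact: (@xgetPex _ 0 [set v | forall w, g p v w = dfun phi p w]
  (ex_intro _ v hv)).
Qed.

(** The terms in [Y(phi)] and [Z(phi)] are exchanged with opposite signs by the gradient terms and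
    cancel; [X(phi) <Y,Z>] appears twice. *)
Lemma Cconf_metric X Y Z :
  g p (Cconf g phi p X Y) Z + g p Y (Cconf g phi p X Z) =
  2 * dfun phi p X * g p Y Z.
Proof.
rewrite /Cconf !(metricDl hg, metricDr hg, metricZl hg, metricZr hg,
  metricNl hg, metricNr hg) gradientE (metricC hg _ Y (gradient _ _ _)) gradientE.
rewrite (metricC hg _ Y X).
move: (dfun phi p X) (dfun phi p Y) (dfun phi p Z) (g p X Y) (g p X Z) (g p Y Z).
by move=> dX dY dZ gXY gXZ gYZ; ring.
Qed.

End Gradient.

(** * The connector and explicit forms of the bundle maps of TTM *)

Section Splitting.
Context {R : realType} {m : nat}.
Local Notation E := 'rV[R]_m.
Context (M : charted E) (hM : is_manifold M).
Local Notation TM := (tangent M).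
Local Notation proj := (@tproj _ _ M).
Local Notation taut := (@tautological _ _ M).
Context (D : M -> E -> (M -> E) -> E) (hD : linear_connection D).
Context (Ds : TM -> E * E -> (TM -> E) -> E) (hDs : is_pullback proj D Ds).
Implicit Types (u : TM) (X Y : E * E).

(** Dombrowski's connection map [kappa]: its kernel is H, and on V it inverts the vertical lift. *)
Definition connector u X : E := Ds u X taut.

Lemma connector_linear u a X Y :
  connector u (a *: X + Y) = a *: connector u X + connector u Y.
Proof. by case: hDs => -[lin _ _ _ _] _; apply: lin; exact: smooth_tautological. Qed.

Lemma connectorD u X Y : connector u (X + Y) = connector u X + connector u Y.
Proof. by rewrite -[X]scale1r connector_linear !scale1r. Qed.

Lemma connector0 u : connector u 0 = 0.
Proof. by apply: (addrI (connector u 0)); rewrite -connectorD !addr0. Qed.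

Lemma connectorZ u a X : connector u (a *: X) = a *: connector u X.
Proof. by rewrite -[a *: X]addr0 connector_linear connector0 addr0. Qed.

Lemma connectorB u X Y : connector u (X - Y) = connector u X - connector u Y.
Proof. by rewrite connectorD -scaleN1r connectorZ scaleN1r. Qed.

Lemma connector_vertical u w : connector u (0, w) = w.
Proof. exact: (pullback_tautological_vertical hM hDs). Qed.

(** H and V meet in 0: the difference is vertical, and the connector is the identity on vertical
    vectors. This gives the uniqueness behind the [xget] definitions. *)
Lemma horizontal_inj u X Y :
  connector u X = 0 -> connector u Y = 0 -> X.1 = Y.1 -> X = Y.
Proof.
move=> hX hY XY; apply/eqP; rewrite -subr_eq0; apply/eqP.
have E0 : X - Y = (0, (X - Y).2).
  by rewrite [LHS]surjective_pairing /= XY subrr.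
by rewrite E0 -(connector_vertical u (X - Y).2) -E0 connectorB hX hY subrr.
Qed.

Lemma hpartE u X : hpart Ds u X = (X.1, X.2 - connector u X).
Proof.
have hX : connector u (X.1, X.2 - connector u X) = 0.
  have -> : (X.1, X.2 - connector u X) = X - (0, connector u X).
    by rewrite -[RHS]/(X.1 - 0, X.2 - connector u X) subr0.
  by rewrite connectorB connector_vertical subrr.
have : [set Y | horizontal Ds u Y /\ vertical u (X - Y)]
    (X.1, X.2 - connector u X).
  by split; rewrite ?verticalE//= subrr.
move=> /(xgetI 0) [hh]; rewrite verticalE//= => /eqP; rewrite subr_eq0 => /eqP h.
by apply: (@horizontal_inj u).
Qed.

Lemma vpartE u X : vpart Ds u X = (0, connector u X).
Proof.
rewrite /vpart hpartE.
rewrite -[LHS]/(X.1 - X.1, X.2 - (X.2 - connector u X)).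
by rewrite subrr opprB addrC subrK.
Qed.

Lemma hliftP u w : connector u (hlift Ds u w) = 0 /\ (hlift Ds u w).1 = w.
Proof.
(* Any vector over [w] has a horizontal part over [w]; [(w, 0)] is the simplest choice. *)
have : [set X | horizontal Ds u X /\ dproj u X = w] (hpart Ds u (w, 0)).
  rewrite hpartE /=; split; last by rewrite dprojE.
  have -> : (w, 0 - connector u (w, 0)) = (w, 0) - (0, connector u (w, 0)).
    by rewrite -[RHS]/(w - 0, 0 - connector u (w, 0)) subr0.
  by rewrite /horizontal /= -/(connector _ _) connectorB connector_vertical subrr.
by move=> /(xgetI 0) [hh]; rewrite dprojE//.
Qed.

Lemma hlift_fst u w : (hlift Ds u w).1 = w.
Proof. exact: (hliftP u w).2. Qed.

Lemma connector_hlift u w : connector u (hlift Ds u w) = 0.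
Proof. exact: (hliftP u w).1. Qed.

Lemma dproj_hpart u X : dproj u (hpart Ds u X) = X.1.
Proof. by rewrite dprojE// hpartE. Qed.

Lemma vdrop_vpart u X : vdrop u (vpart Ds u X) = connector u X.
Proof. by rewrite vpartE vdropE. Qed.

Lemma theta_mapE u X : theta_map Ds u X = (0, X.1).
Proof. by rewrite /theta_map dproj_hpart vliftE. Qed.

Lemma theta_tE u X : theta_t Ds u X = hlift Ds u (connector u X).
Proof. by rewrite /theta_t vdrop_vpart. Qed.

Context (g : M -> E -> E -> R) (hg : is_riemannian g).

Lemma gweightedE f1 f2 u X Y : gweighted Ds g f1 f2 u X Y =
  f1 (proj u) * g (proj u) X.1 Y.1
  + f2 (proj u) * g (proj u) (connector u X) (connector u Y).
Proof.
(* Rewriting here would compare hpart Ds u X with hpart Ds u Y up to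
   conversion, which unfolds xget and the derivatives. *)
rewrite /gweighted /gV; congr (_ * g _ _ _ + _ * g _ _ _).
- exact: dproj_hpart.
- exact: dproj_hpart.
- exact: vdrop_vpart.
- exact: vdrop_vpart.
Qed.

Lemma canon_vertE u : canon_vert u = (0, u.2).
Proof. by rewrite /canon_vert vliftE. Qed.

Lemma sasaki_canon_vert u X :
  sasaki Ds g u (canon_vert u) X = g (proj u) u.2 (connector u X).
Proof.
by rewrite /sasaki gweightedE canon_vertE /= metric0l// mulr0 add0r mul1r
  connector_vertical.
Qed.

Lemma mu_formE u X : mu_form Ds g u X = g (proj u) u.2 X.1.
Proof. by rewrite /mu_form sasaki_canon_vert theta_mapE connector_vertical. Qed.

Lemma rsqE u : rsq Ds g u = g (proj u) u.2 u.2.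
Proof.
by rewrite /rsq sasaki_canon_vert canon_vertE connector_vertical.
Qed.

Lemma Omega_rsq u X :
  Omega Ds g u X * rsq Ds g u = g (proj u) u.2 (connector u X).
Proof.
rewrite /Omega rsqE sasaki_canon_vert vpartE connector_vertical.
(* On the zero section the inverse of [rsq] is 0 by convention, and both sides vanish because
   positivity of [g] forces [u.2 = 0]. *)
have [u0|u0] := eqVneq (g (proj u) u.2 u.2) 0; last by rewrite mulrC mulVKf.
by rewrite (metric_eq0 hg u0) !metric0l// mulr0.
Qed.

Lemma mu_theta_t u X :
  mu_form Ds g u (theta_t Ds u X) = Omega Ds g u X * rsq Ds g u.
Proof. by rewrite mu_formE theta_tE hlift_fst Omega_rsq. Qed.

Lemma pullCE phi u X Y :
  pullC Ds g phi u X Y = hlift Ds u (Cconf g phi (proj u) X.1 Y.1).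
Proof.
exact: (f_equal2 (fun x y => hlift Ds u (Cconf g phi (proj u) x y))
  (dproj_hpart u X) (dproj_hpart u Y)).
Qed.

(** The summand in V has base component 0. Dually, in [connector_Dtilde] the connector kills the
    summand in H, so the two components of [Dtilde] are computed independently. *)
Lemma Dtilde_fst phi1 phi2 u X (Y : TM -> E * E) :
  (Dtilde Ds g phi1 phi2 u X Y).1 =
  Ds u X (fun w => (Y w).1) + Cconf g phi1 (proj u) X.1 (Y u).1.
Proof.
have -> : (Dtilde Ds g phi1 phi2 u X Y).1 =
    (nablaH_conf Ds g phi1 u X (fun w => hpart Ds w (Y w))).1
    + (nablaV_conf Ds g phi2 u X (fun w => vpart Ds w (Y w))).1 by [].
have -> : (nablaV_conf Ds g phi2 u X (fun w => vpart Ds w (Y w))).1 = 0.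
  by rewrite /nablaV_conf /nablaV vliftE// theta_mapE /= addr0.
rewrite addr0 /nablaH_conf /nablaH pullCE hpartE /= !hlift_fst.
congr (Ds u X _ + _).
by apply/funext => w; rewrite dproj_hpart.
Qed.

Lemma connector_Dtilde phi1 phi2 u X (Y : TM -> E * E) :
  connector u (Dtilde Ds g phi1 phi2 u X Y) =
  Ds u X (fun w => connector w (Y w))
  + Cconf g phi2 (proj u) X.1 (connector u (Y u)).
Proof.
rewrite /Dtilde connectorD /nablaH_conf /nablaH connectorD !connector_hlift.
rewrite !add0r /nablaV_conf /nablaV connectorD vliftE//.
rewrite theta_mapE pullCE hlift_fst theta_tE hlift_fst vpartE.
rewrite !connector_vertical; congr (Ds u X _ + _).
by apply/funext => w; rewrite vdrop_vpart.
Qed.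

End Splitting.

(** * Parallelism *)

Section Parallel.
Context {R : realType} {m : nat}.
Local Notation E := 'rV[R]_m.
Context (M : charted E) (hM : is_manifold M).
Local Notation TM := (tangent M).
Local Notation proj := (@tproj _ _ M).
Local Notation taut := (@tautological _ _ M).
Context (g : M -> E -> E -> R) (hg : is_riemannian g).
Context (D : M -> E -> (M -> E) -> E) (hD : linear_connection D).
Context (hDg : forall p : M, parallel_at D g p).
Context (Ds : TM -> E * E -> (TM -> E) -> E) (hDs : is_pullback proj D Ds).
Implicit Types (u : TM) (X : E * E) (Y Z : TM -> E * E).

(** The weight factors through the projection and is an exponential: its logarithmic derivative is
    [2 X(phi)], the very factor produced by [Cconf_metric]. *)
Lemma is_derive_conformal (phi f : M -> R) u X :
  smooth_fun phi (proj u) -> (forall p, f p = expR (2 * phi p)) ->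
  is_derive (pcoord u u) X ((f \o proj) \o pparam u : E * E -> R^o)
    (2 * dfun phi (proj u) X.1 * f (proj u)).
Proof.
move=> sphi hf.
pose h : E -> R^o := phi \o pparam u.1.
pose e : R^o -> R^o := fun t => expR (2 * t).
have dh : differentiable h (pcoord u.1 u.1) by exact: smooth_at_differentiable.
have de (t : R^o) : is_derive t 1 e (2 * expR (2 * t)).
  have d2 : is_derive t 1 ( *%R 2 : R^o -> R^o) (2 : R^o).
    have := is_deriveZ (2 : R) (is_derive_id t (1 : R^o)).
    by rewrite /GRing.scale /= mulr1.
  apply: (is_derive_eq (is_derive1_comp (is_derive_expR (2 * t)) d2)).
  by rewrite mulrC.
have hp : pparam u.1 (pcoord u.1 u.1) = u.1.
  by apply: coordK => //; exact: pref_dom.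
have -> : (f \o proj) \o pparam u = (e \o h) \o fst :> (E * E -> R).
  by apply/funext => x; rewrite /e /h /= hf.
apply: is_derive_fst.
have De (t : R^o) : differentiable e t.
  by apply/derivable1_diffP; have := de t; case.
split; first by apply/diff_derivable/differentiable_comp.
rewrite derive_comp//.
(* Writing the scalar direction as itself times 1 reduces to the ordinary derivative [de], by
   linearity of the differential. *)
rewrite deriveE// -[X in 'd e _ X]mulr1 [LHS]linearZ -deriveE//.
have [_ ->] := de (h (pcoord u u).1).
rewrite /h /= hp hf /GRing.scale /= /dfun /=.
by rewrite mulrCA mulrA.
Qed.

Lemma is_derive_prod u X (F G : TM -> R^o) (dF dG : R) :
  is_derive (pcoord u u) X (F \o pparam u) dF ->
  is_derive (pcoord u u) X (G \o pparam u) dG ->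
  is_derive (pcoord u u) X ((fun w => F w * G w) \o pparam u : E * E -> R^o)
    (F u * dG + G u * dF).
Proof.
move=> hF hG; apply: (is_derive_eq (is_deriveM hF hG)).
by rewrite -[in RHS](pparam_pcoord hM u).
Qed.

(** The covariant derivative of the smooth tautological section along a smooth field is smooth, by
    the last clause of [is_connection]. *)
Lemma smooth_connector Y u : smooth_field Y u ->
  smooth_section proj (fun w => connector Ds w (Y w)) u.
Proof.
case: hDs => -[_ _ _ _ smD] _ hY; apply: smD => //.
exact: smooth_tautological.
Qed.

Lemma Cconf_metricD (phi : M -> R) (p : M) (v y z a b : E) : smooth_fun phi p ->
  g p (a + Cconf g phi p v y) z + g p y (b + Cconf g phi p v z) =
  g p a z + g p y b + 2 * dfun phi p v * g p y z.
Proof.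
move=> sphi; rewrite (metricDl hg _ a) (metricDr hg _ _ b) addrACA.
by rewrite Cconf_metric.
Qed.

Lemma sum_weighted (l a b p1 p2 q1 q2 p q : R) :
  p1 + p2 = p -> q1 + q2 = q -> l = a * p + b * q ->
  l = a * p1 + b * q1 + (a * p2 + b * q2).
Proof. by move=> <- <- ->; ring. Qed.

(** [pullback_metric] is applied to the sections [d pi Y] and [kappa Y]. In each block the
    derivative of the weight is balanced by the failure of [C_i] to be skew for [g]. *)
Lemma parallel_gweighted (phi1 phi2 f1 f2 : M -> R) u :
  (forall p, smooth_fun phi1 p) -> (forall p, smooth_fun phi2 p) ->
  (forall p, f1 p = expR (2 * phi1 p)) ->
  (forall p, f2 p = expR (2 * phi2 p)) ->
  parallel_at (Dtilde Ds g phi1 phi2) (gweighted Ds g f1 f2) u.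
Proof.
move=> s1 s2 h1 h2 X Y Z sY sZ _ _.
have EB : (fun w => gweighted Ds g f1 f2 w (Y w) (Z w)) = (fun w =>
    f1 (proj w) * g w.1 (Y w).1 (Z w).1 +
    f2 (proj w) * g w.1 (connector Ds w (Y w)) (connector Ds w (Z w))).
  by apply/funext => w; exact: (gweightedE hM hD hDs).
rewrite EB {EB}.
have dH := pullback_metric hM hDs hg hDg X (smooth_section_fst hM sY)
  (smooth_section_fst hM sZ).
have dV := pullback_metric hM hDs hg hDg X (smooth_connector sY)
  (smooth_connector sZ).
have d1 := is_derive_conformal X (s1 (proj u)) h1.
have d2 := is_derive_conformal X (s2 (proj u)) h2.
apply: (is_derive_eq (is_deriveD (is_derive_prod d1 dH)
  (is_derive_prod d2 dV))).
have EY := gweightedE hM hD hDs g f1 f2 u (Dtilde Ds g phi1 phi2 u X Y) (Z u).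
have EZ := gweightedE hM hD hDs g f1 f2 u (Y u) (Dtilde Ds g phi1 phi2 u X Z).
rewrite (Dtilde_fst hM hD hDs) (connector_Dtilde hM hD hDs) in EY.
rewrite (Dtilde_fst hM hD hDs) (connector_Dtilde hM hD hDs) in EZ.
apply: etrans (esym (f_equal2 +%R EY EZ)).
apply: (sum_weighted (Cconf_metricD X.1 (Y u).1 (Z u).1
    (Ds u X (fun w => (Y w).1)) (Ds u X (fun w => (Z w).1)) (s1 (proj u)))
  (Cconf_metricD X.1 (connector Ds u (Y u))
    (connector Ds u (Z u)) (Ds u X (fun w => connector Ds w (Y w)))
    (Ds u X (fun w => connector Ds w (Z w))) (s2 (proj u)))).
move: (g _ _ _) (g _ _ _) (g _ _ _) (g _ _ _) (g _ _ _) (g _ _ _) => a b c d e f.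
rewrite -[(f1 \o proj) u]/(f1 (proj u)) -[(f2 \o proj) u]/(f2 (proj u)).
ring.
Qed.

Lemma Cconf_const (phi : M -> R) (c : R) (p : M) (v w : E) :
  (forall q, smooth_fun phi q) -> (forall q, phi q = c) ->
  Cconf g phi p v w = 0.
Proof.
move=> sphi hc; have d0 z : dfun phi p z = 0.
  rewrite /dfun (_ : phi \o pparam p = cst c) ?derive_cst//.
  by apply/funext => x; exact: hc.
(* The gradient vanishes because its product with every vector, itself included, is 0. *)
rewrite /Cconf !d0 !scale0r !add0r (metric_eq0 hg (p := p) (v := gradient g phi p)).
  by rewrite scaler0 oppr0.
by rewrite gradientE.
Qed.



(** The base component of [K_X Y] is [mu(Y)] times this vector, with [a = f1] and [b = f3]. The
    product of [r^2] and [Omega(X)] is merged into [<xi, kappa X>], so no division by [r^2]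
    remains. *)
Definition Kvector (a b : R) u X : E := (b / a) *: connector Ds u X
  - (b ^+ 2 / ((g (proj u) u.2 u.2 * b + a) * a)
     * g (proj u) u.2 (connector Ds u X)) *: u.2.

Lemma Ktensor_fst f1 f3 u X (v : E * E) :
  (Ktensor Ds g f1 f3 u X v).1 =
  g (proj u) u.2 v.1 *: Kvector (f1 (proj u)) (f3 (proj u)) u X.
Proof.
rewrite /Ktensor (mu_formE hM hD hDs hg).
rewrite -[LHS]/(_ *: (_ *: (theta_t Ds u X).1
  - _ *: (theta_t Ds u (canon_vert u)).1)).
have tX := theta_tE hM hD hDs u X; rewrite {}tX.
have tx := theta_tE hM hD hDs u (canon_vert u); rewrite {}tx.
rewrite !(hlift_fst hM hD hDs) canon_vertE// (connector_vertical hM hD hDs).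
rewrite /Kvector -(Omega_rsq hM hD hDs hg) (rsqE hM hD hDs hg).
congr (_ *: (_ - _ *: _)); move: (Omega _ _ _ _) (_^-1) => o d.
ring.
Qed.

Lemma connector_Ktensor f1 f3 u X (v : E * E) :
  connector Ds u (Ktensor Ds g f1 f3 u X v) = 0.
Proof.
have H (x y : E * E) (k a b : R) : connector Ds u x = 0 ->
    connector Ds u y = 0 -> connector Ds u (k *: (a *: x - b *: y)) = 0.
  move=> hx hy; rewrite (connectorZ hM hDs) (connectorB hM hDs).
  by rewrite !(connectorZ hM hDs) hx hy !scaler0 subr0 scaler0.
have T x : connector Ds u (theta_t Ds u x) = 0.
  by rewrite (theta_tE hM hD hDs) (connector_hlift hM hD hDs).
exact: H (T X) (T (canon_vert u)).
Qed.

(** [Kvector] is the solution [k] of [a k + b <xi,k> xi = b kappa X], a rank-one perturbation of a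
    homothety inverted by the Sherman-Morrison formula; the second nonvanishing condition is its
    denominator. *)
Lemma Kvector_metric (a b : R) u X (z : E) :
  a != 0 -> g (proj u) u.2 u.2 * b + a != 0 ->
  a * g (proj u) (Kvector a b u X) z
    + b * (g (proj u) u.2 (Kvector a b u X) * g (proj u) u.2 z) =
  b * g (proj u) (connector Ds u X) z.
Proof.
move=> a0 d0; pose x := connector Ds u X; pose p := proj u.
rewrite /Kvector -/x -/p; set k := (_ * g p u.2 x).
rewrite (metricDl hg _ _ _ z) (metricDr hg _ u.2).
rewrite (metricNl hg) (metricNr hg) !(metricZl hg) !(metricZr hg) {}/k.
rewrite -/p in d0.
move: (g p u.2 u.2) (g p u.2 x) (g p u.2 z) (g p x z) d0 => r s t w d0.
field.
by rewrite d0 a0.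
Qed.

(** The closing identity of (ii) over the reals. Here [y], [z] stand for [mu(Y)], [mu(Z)]; [xy],
    [xz] for the products of [kappa X] with [Y.1], [Z.1]; [dy], [dz] for those of [xi] with the
    derivatives of [d pi Y], [d pi Z]; [ky], [kz], [xk] for those of [Kvector] with [Y.1], [Z.1],
    [xi]. The factor 0 is the derivative of the constant [f3]. *)
Lemma sum_parallel (a b c p1 p2 q1 q2 y z xz xy dz dy kz ky xk : R) :
  a * kz + c * (xk * z) = c * xz -> a * ky + c * (xk * y) = c * xy ->
  a * p1 + b * q1 + (a * p2 + b * q2)
    + (c * (y * (xz + dz) + z * (xy + dy)) + y * z * 0) =
  a * (p1 + y * kz) + b * q1 + c * ((dy + y * xk) * z)
    + (a * (p2 + z * ky) + b * q2 + c * (y * (dz + z * xk))).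
Proof.
move=> hz hy; have -> : c * (y * (xz + dz) + z * (xy + dy)) + y * z * 0 =
    y * (c * xz) + z * (c * xy) + c * (y * dz + z * dy) by ring.
by rewrite -hz -hy; ring.
Qed.

(** The form [mu] is not parallel, since the derivative of [xi] along [X] is [kappa X]; the
    resulting terms are exactly those which [K] contributes through [Kvector_metric]. *)
Lemma parallel_Gmetric (phi1 phi2 f1 f2 f3 : M -> R) (c1 c3 : R) u :
  (forall p, smooth_fun phi1 p) -> (forall p, smooth_fun phi2 p) ->
  (forall p, f1 p = expR (2 * phi1 p)) ->
  (forall p, f2 p = expR (2 * phi2 p)) ->
  (forall p, f1 p = c1) -> (forall p, f3 p = c3) ->
  g (proj u) u.2 u.2 * c3 + c1 != 0 ->
  parallel_at (Dtildetilde Ds g phi1 phi2 f1 f3) (Gmetric Ds g f1 f2 f3) u.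
Proof.
move=> s1 s2 h1 h2 hc1 hc3 d0 X Y Z sY sZ tY tZ.
have c10 : c1 != 0 by rewrite -(hc1 (proj u)) h1 gt_eqF// expR_gt0.
have phi1E p : phi1 p = ln c1 / 2.
  by rewrite -(hc1 p) h1 expRK mulrC mulrA mulVf ?mul1r.
have GE w (v z : E * E) : Gmetric Ds g f1 f2 f3 w v z =
    gweighted Ds g f1 f2 w v z
    + c3 * (g (proj w) w.2 v.1 * g (proj w) w.2 z.1).
  rewrite /Gmetric hc3.
  exact: (f_equal2 (fun a b => gweighted Ds g f1 f2 w v z + c3 * (a * b))
    (mu_formE hM hD hDs hg w v) (mu_formE hM hD hDs hg w z)).
have EB : (fun w => Gmetric Ds g f1 f2 f3 w (Y w) (Z w)) = (fun w =>
    gweighted Ds g f1 f2 w (Y w) (Z w)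
    + c3 * (g w.1 w.2 (Y w).1 * g w.1 w.2 (Z w).1)).
  by apply/funext => w; exact: GE.
rewrite EB {EB}.
have dW := parallel_gweighted s1 s2 h1 h2 X sY sZ tY tZ.
(* As [mu(Y) = <xi, d pi Y>], metric compatibility with the tautological section as one argument
   differentiates [mu(Y)]. *)
have dmY := pullback_metric hM hDs hg hDg X (smooth_tautological hM u)
  (smooth_section_fst hM sY).
have dmZ := pullback_metric hM hDs hg hDg X (smooth_tautological hM u)
  (smooth_section_fst hM sZ).
have dC := is_derive_cst (c3 : R^o) (pcoord u u) X.
apply: (is_derive_eq (is_deriveD dW
  (is_derive_prod (F := fun=> c3) dC (is_derive_prod dmY dmZ)))).
have EY := GE u (Dtildetilde Ds g phi1 phi2 f1 f3 u X Y) (Z u).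
have EZ := GE u (Y u) (Dtildetilde Ds g phi1 phi2 f1 f3 u X Z).
have D1 W : (Dtilde Ds g phi1 phi2 u X W).1 = Ds u X (fun w => (W w).1).
  by rewrite (Dtilde_fst hM hD hDs) (Cconf_const _ _ _ s1 phi1E) addr0.
have DD1 W : (Dtildetilde Ds g phi1 phi2 f1 f3 u X W).1 =
    Ds u X (fun w => (W w).1) + g (proj u) u.2 (W u).1 *: Kvector c1 c3 u X.
  rewrite /Dtildetilde -[LHS]/(_.1 + _.1) D1 Ktensor_fst.
  by rewrite hc1 hc3.
(* [K] takes horizontal values, so the vertical block is that of [Dtilde]. *)
have DDk W : connector Ds u (Dtildetilde Ds g phi1 phi2 f1 f3 u X W) =
    connector Ds u (Dtilde Ds g phi1 phi2 u X W).
  by rewrite /Dtildetilde (connectorD hM hDs) connector_Ktensor addr0.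
have WY := gweightedE hM hD hDs g f1 f2 u (Dtilde Ds g phi1 phi2 u X Y) (Z u).
have WZ := gweightedE hM hD hDs g f1 f2 u (Y u) (Dtilde Ds g phi1 phi2 u X Z).
have WWY := gweightedE hM hD hDs g f1 f2 u
  (Dtildetilde Ds g phi1 phi2 f1 f3 u X Y) (Z u).
have WWZ := gweightedE hM hD hDs g f1 f2 u (Y u)
  (Dtildetilde Ds g phi1 phi2 f1 f3 u X Z).
have gKl (a k z : E) c : g (proj u) (a + c *: k) z =
    g (proj u) a z + c * g (proj u) k z.
  by rewrite (metricDl hg) (metricZl hg).
have gKr (a k z : E) c : g (proj u) z (a + c *: k) =
    g (proj u) z a + c * g (proj u) k z.
  by rewrite (metricDr hg) (metricZr hg) [g _ k z](metricC hg).
rewrite (D1 Y) hc1 in WY; rewrite (D1 Z) hc1 in WZ.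
rewrite (DD1 Y) (DDk Y) hc1 gKl in WWY.
rewrite (DD1 Z) (DDk Z) hc1 gKr in WWZ.
rewrite (DD1 Y) gKr in EY; rewrite (DD1 Z) gKr in EZ.
apply: (etrans (f_equal2 +%R (f_equal2 +%R WY WZ) erefl)).
have {WWY}EY := etrans EY (f_equal2 +%R WWY erefl).
have {WWZ}EZ := etrans EZ (f_equal2 +%R WWZ erefl).
apply: etrans (esym (f_equal2 +%R EY EZ)).
have KY := Kvector_metric X (Y u).1 c10 d0.
have KZ := Kvector_metric X (Z u).1 c10 d0.
rewrite [g _ u.2 (Kvector _ _ _ _)](metricC hg) in KY KZ.
exact: sum_parallel KZ KY.
Qed.

Lemma vdrop_vertical u (v : E * E) : vertical u v ->
  vdrop u v = connector Ds u v.
Proof.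
rewrite verticalE// => v0; have -> : v = (0, v.2).
  by rewrite [LHS]surjective_pairing v0.
by rewrite vdropE// (connector_vertical hM hD hDs).
Qed.

(** The term [X(phi2) Y] contributes once from each argument, which matches the derivative of the
    weight. Since [vdrop] is meaningful only on vertical vectors, it is replaced near [u] by the
    connector, whose smoothness is known. *)
Lemma parallel_gV (phi2 f2 : M -> R) u :
  (forall p, smooth_fun phi2 p) -> (forall p, f2 p = expR (2 * phi2 p)) ->
  parallel_on vertical (nablaV_conf' Ds phi2) (gV g f2) u.
Proof.
move=> s2 h2 X Y Z sY sZ vY vZ.
have cYE : nearby u (fun w => connector Ds w (Y w) = vdrop w (Y w)).
  by apply: filterS vY => x vx; rewrite vdrop_vertical.
have cZE : nearby u (fun w => connector Ds w (Z w) = vdrop w (Z w)).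
  by apply: filterS vZ => x vx; rewrite vdrop_vertical.
have at_u (P : set TM) : nearby u P -> P u.
  by move=> nP; have := nbhs_singleton nP; rewrite pparam_pcoord.
have vYu : vertical u (Y u).
  exact (at_u (fun w => vertical w (Y w)) vY).
have vZu : vertical u (Z u).
  exact (at_u (fun w => vertical w (Z w)) vZ).
have cY := smooth_connector sY; have cZ := smooth_connector sZ.
have dV := pullback_metric hM hDs hg hDg X cY cZ.
have d2 := is_derive_conformal X (s2 (proj u)) h2.
have nE W : smooth_field W u -> vertical u (W u) ->
    nearby u (fun w => connector Ds w (W w) = vdrop w (W w)) ->
    vdrop u (nablaV_conf' Ds phi2 u X W) =
    Ds u X (fun w => connector Ds w (W w))
    + dfun phi2 (proj u) X.1 *: connector Ds u (W u).
  move=> sW vW cW; have cs := smooth_connector sW.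
  (* The derivative of [phi2 \o tproj] along [X] has the same difference quotients as that of [phi2]
     along [X.1], so the two agree by conversion. *)
  have -> : nablaV_conf' Ds phi2 u X W =
      (0, Ds u X (fun w => vdrop w (W w))) + dfun phi2 (proj u) X.1 *: W u.
    by rewrite /nablaV_conf' /nablaV vliftE.
  rewrite vdrop_vertical; last first.
    move: vW; rewrite !verticalE//= => ->.
    by rewrite scaler0 addr0.
  rewrite (connectorD hM hDs) (connectorZ hM hDs).
  rewrite (connector_vertical hM hD hDs); congr (_ + _).
  by case: hDs => -[_ _ _ loc _] _; rewrite (loc _ _ _ _ cs cW).
have dP := is_derive_prod d2 dV.
apply: (is_derive_eq (near_eq_is_derive _ dP)).
  near=> x; have ey : connector Ds (pparam u x) (Y (pparam u x)) =
      vdrop (pparam u x) (Y (pparam u x)) by near: x; exact: cYE.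
  have ez : connector Ds (pparam u x) (Z (pparam u x)) =
      vdrop (pparam u x) (Z (pparam u x)) by near: x; exact: cZE.
  exact: (f_equal2 (fun v w => f2 (proj (pparam u x))
    * g (proj (pparam u x)) v w) ey ez).
have EY := f_equal2 (fun v w => f2 (proj u) * g (proj u) v w)
  (nE Y sY vYu cYE) (vdrop_vertical vZu).
have EZ := f_equal2 (fun v w => f2 (proj u) * g (proj u) v w)
  (vdrop_vertical vYu) (nE Z sZ vZu cZE).
apply: etrans (esym (f_equal2 +%R EY EZ)).
rewrite !(metricDl hg, metricDr hg, metricZl hg, metricZr hg).
rewrite -[(f2 \o proj) u]/(f2 (proj u)).
move: (g _ _ _) (g _ _ _) (g _ _ _) => a b c.
ring.
Unshelve. all: by end_near. Qed.


End Parallel.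

Theorem proposition0p1 (R : realType) (m : nat) (hm : (2 <= m)%N)
    (M : charted 'rV[R]_m) (hM : is_manifold M)
    (g : M -> 'rV[R]_m -> 'rV[R]_m -> R) (hg : is_riemannian g)
    (D : M -> 'rV[R]_m -> (M -> 'rV[R]_m) -> 'rV[R]_m)
    (hD : linear_connection D)
    (hDg : forall p : M, parallel_at D g p)
    (Ds : tangent M -> 'rV[R]_m * 'rV[R]_m ->
          (tangent M -> 'rV[R]_m) -> 'rV[R]_m)
    (hDs : is_pullback tproj D Ds)
    (phi1 phi2 f1 f2 f3 : M -> R)
    (hphi1 : forall p : M, smooth_fun phi1 p)
    (hphi2 : forall p : M, smooth_fun phi2 p)
    (hf3 : forall p : M, smooth_fun f3 p)
    (hf1E : forall p : M, f1 p = expR (2 * phi1 p))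
    (hf2E : forall p : M, f2 p = expR (2 * phi2 p))
    (hf13 : forall p : M, 0 < f1 p + f3 p) :
  [/\ (* (i) *)
      (forall p : M, f3 p = 0) ->
        forall u : tangent M,
          parallel_at (Dtilde Ds g phi1 phi2) (gweighted Ds g f1 f2) u,
      (* (ii) *)
      (exists c1 : R, forall p : M, f1 p = c1) ->
      (exists c3 : R, forall p : M, f3 p = c3) ->
        (forall (u : tangent M) (X : 'rV[R]_m * 'rV[R]_m),
           mu_form Ds g u (theta_t Ds u X) = Omega Ds g u X * rsq Ds g u) /\
        (forall u : tangent M,
           rsq Ds g u * f3 (tproj u) + f1 (tproj u) != 0 ->
           parallel_at (Dtildetilde Ds g phi1 phi2 f1 f3)
             (Gmetric Ds g f1 f2 f3) u) &
      (* (iii) *)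
      forall u : tangent M,
        parallel_on vertical (nablaV_conf' Ds phi2) (gV g f2) u].
Proof.
split.
- by move=> _ u; exact: (parallel_gweighted hM hg hD hDg hDs).
- move=> [c1 hc1] [c3 hc3]; split=> u; first exact: (mu_theta_t hM hD hDs hg).
  (* With [r^2] written as [<xi, xi>], the assumption on [u] becomes the nonvanishing of the
     denominator in [K]. *)
  have r2 := rsqE hM hD hDs hg u.
  rewrite r2 hc1 hc3 => d0.
  exact: (parallel_Gmetric hM hg hD hDg hDs hphi1 hphi2 hf1E hf2E hc1 hc3 d0).
- by move=> u; exact: (parallel_gV hM hg hD hDg hDs hphi2 hf2E).
Qed.
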